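(* Let $\mathcal M$ be a real symmetric $2d\times 2d$ matrix, $H(z)=\frac12\langle\mathcal Mz,z\rangle$ for $z=(x,\xi)\in\mathbb R^{2d}$, and let $u$ be the solution of the Schrödinger equation $i\hbar\,\partial_t u(x,t)=H_Du(x,t)$ with $\hbar=1/(2\pi)$ and initial datum $u(\cdot,0)=u_0\in\mathcal S(\mathbb R^d)$, i.e. $u(\cdot,t)=\hat S_tu_0$. Let $M,N$ be real symmetric positive-definite $d\times d$ matrices and suppose that for some $t_1$ and some constant $c>0$, $$|u(x,0)|\le c\,e^{-\pi Mx\cdot x},\qquad |u(x,t_1)|\le c\,e^{-\pi Nx\cdot x},\qquad x\in\mathbb R^d.$$ Assume that the symplectic matrix $S_{t_1}=\exp(t_1J\mathcal M)=\begin{pmatrix}A&B(t_1)\\C&D\end{pmatrix}$ has invertible upper-right block $B(t_1)$. Let $\lambda_1,\dots,\lambda_d$ be the eigenvalues of $MB(t_1)^TNB(t_1)$. If $\lambda_j>1$ for some $j\in\{1,\dots,d\}$, then $u_0\equiv 0$.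
   Context: $J=\begin{pmatrix}0_d&I_d\\-I_d&0_d\end{pmatrix}$; $\mathrm{Sp}(d,\mathbb R)=\{S\in\mathbb R^{2d\times2d}:S^TJS=J\}$, with $d\times d$ block decomposition $S=\begin{pmatrix}A&B\\C&D\end{pmatrix}$. $H_D$ is the Weyl quantization of $H$: $H_Df(x)=\int_{\mathbb R^{2d}}e^{2\pi i(x-y)\cdot\xi}H\big(\tfrac{x+y}{2},\xi\big)f(y)\,dy\,d\xi$. The cross-Wigner distribution is $W(f,g)(x,\xi)=\int f(x+t/2)\overline{g(x-t/2)}e^{-2\pi i\xi\cdot t}dt$, and a metaplectic operator with projection $S\in\mathrm{Sp}(d,\mathbb R)$ is a unitary $\hat S$ on $L^2(\mathbb R^d)$ with $W(\hat Sf,\hat Sg)(z)=W(f,g)(S^{-1}z)$ for all $f,g,z$. The flow $S_t=\exp(tJ\mathcal M)$ is a one-parameter subgroup of $\mathrm{Sp}(d,\mathbb R)$, and $t\mapsto\hat S_t$ is its unique continuous lift to metaplectic operators with $\hat S_0=\mathrm{id}$ ($\hat S_t$ has projection $S_t$); the solution of the initial value problem is $u(\cdot,t)=\hat S_tu_0$. *)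

(* Defs.v *)
From mathcomp Require Import all_boot all_order all_algebra.
From mathcomp Require Import all_classical all_reals all_analysis.
From mathcomp Require Import complex.
Import Order.TTheory GRing.Theory Num.Theory.

Set Implicit Arguments.
Unset Strict Implicit.
Unset Printing Implicit Defensive.

Local Open Scope ring_scope.
Local Open Scope classical_set_scope.

Section Defs.
Context {R : realType}.

(* the measurable (Borel, product sigma-algebra) structure of R^n is
   transported from the library's n.-tuple R *)
Definition row_of_tuple n (t : n.-tuple R) : 'rV[R]_n := \row_i tnth t i.

Definition Rd_measurable n (A : set 'rV[R]_n) : Prop :=
  measurable (@row_of_tuple n @^-1` A).

Definition Rd_measurable_fun n (f : 'rV[R]_n -> R) : Prop :=
  measurable_fun setT (f \o @row_of_tuple n).

Definition vcons n (a : R) (y : 'rV[R]_n) : 'rV[R]_n.+1 :=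
  \row_(i < n.+1) match unlift ord0 i with Some j => y ord0 j | None => a end.

(* Lebesgue integral on R^n of a nonnegative (extended) function, computed as
   the iterated one-dimensional Lebesgue integral (= the product-measure
   integral for measurable functions, by Tonelli) *)
Fixpoint Rd_int_nn (n : nat) : ('rV[R]_n -> \bar R) -> \bar R :=
  match n return ('rV[R]_n -> \bar R) -> \bar R with
  | 0 => fun f => f 0
  | n'.+1 => fun f =>
      integral (@lebesgue_measure R) setT (fun a => Rd_int_nn (fun y => f (vcons a y)))
  end.

(* Lebesgue integral on R^n of a real integrable function, as the iterated
   one-dimensional Lebesgue integral (= the product-measure integral for
   integrable functions, by Fubini) *)
Fixpoint Rd_int (n : nat) : ('rV[R]_n -> R) -> R :=
  match n return ('rV[R]_n -> R) -> R with
  | 0 => fun f => f 0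
  | n'.+1 => fun f =>
      Rintegral (@lebesgue_measure R) setT (fun a => Rd_int (fun y => f (vcons a y)))
  end.

Definition Rd_cint n (h : 'rV[R]_n -> R[i]) : R[i] :=
  Complex (Rd_int (fun x => complex.Re (h x))) (Rd_int (fun x => complex.Im (h x))).

Definition cmod (z : R[i]) : R :=
  Num.sqrt (complex.Re z ^+ 2 + complex.Im z ^+ 2).

Definition expi (theta : R) : R[i] := Complex (cos theta) (sin theta).

Definition dotv n (x y : 'rV[R]_n) : R := (x *m y^T) ord0 ord0.

Definition qform n (M : 'M[R]_n) (x : 'rV[R]_n) : R := dotv (x *m M^T) x.

Definition Rd_null n (A : set 'rV[R]_n) : Prop :=
  exists B, [/\ Rd_measurable B, A `<=` B &
                Rd_int_nn (fun x => (\1_B x : R)%:E) = 0%E].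

Definition ae_Rd n (P : 'rV[R]_n -> Prop) : Prop := Rd_null [set x | ~ P x].

Definition ae_eqc n (f g : 'rV[R]_n -> R[i]) : Prop := ae_Rd (fun x => f x = g x).

Definition L2norm2 n (f : 'rV[R]_n -> R[i]) : \bar R :=
  Rd_int_nn (fun x => ((cmod (f x)) ^+ 2)%:E).

Definition L2 n (f : 'rV[R]_n -> R[i]) : Prop :=
  [/\ Rd_measurable_fun (fun x => complex.Re (f x)),
      Rd_measurable_fun (fun x => complex.Im (f x)) &
      (L2norm2 f < +oo)%E].

Definition dpart n (s : seq 'I_n) (f : 'rV[R]_n -> R) : 'rV[R]_n -> R :=
  foldr (fun i g => fun x => 'D_(delta_mx ord0 i) g x) f s.

Definition schwartz_real n (f : 'rV[R]_n -> R) : Prop :=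
  (forall s x, differentiable (dpart s f) x) /\
  (forall (s : seq 'I_n) (k : nat), exists C : R, forall x,
      (1 + `|x|) ^+ k * `|dpart s f x| <= C).

Definition schwartz n (f : 'rV[R]_n -> R[i]) : Prop :=
  schwartz_real (fun x => complex.Re (f x)) /\ schwartz_real (fun x => complex.Im (f x)).

Definition Jmx d : 'M[R]_(d + d) := block_mx 0 1%:M (- 1%:M) 0.

Definition expmx m (A : 'M[R]_m) : 'M[R]_m :=
  limn (fun N => \sum_(k < N) (k`!%:R)^-1 *: A ^+ k).

Definition symp_flow d (Mc : 'M[R]_(d + d)) (t : R) : 'M[R]_(d + d) :=
  expmx (t *: (Jmx d *m Mc)).

Definition mxapp m (S : 'M[R]_m) (z : 'rV[R]_m) : 'rV[R]_m := (S *m z^T)^T.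

Definition wigner d (f g : 'rV[R]_d -> R[i]) (z : 'rV[R]_(d + d)) : R[i] :=
  let x := lsubmx z in let xi := rsubmx z in
  Rd_cint (fun t => f (x + 2^-1 *: t) * Num.conj (g (x - 2^-1 *: t))
                    * expi (- (2 * pi * dotv xi t))).

(* V is a unitary operator of L^2(R^d) (linear, isometric, onto; operators act
   on representatives, equalities in L^2 are a.e.) with
   W(Vf, Vg)(z) = W(f,g)(S^{-1} z) *)
Definition metaplectic d (S : 'M[R]_(d + d))
    (V : ('rV[R]_d -> R[i]) -> ('rV[R]_d -> R[i])) : Prop :=
  [/\ (forall f, L2 f -> L2 (V f)),
      (forall (a : R[i]) f g, L2 f -> L2 g ->
          ae_eqc (V (fun x => f x + a * g x)) (fun x => V f x + a * V g x)),
      (forall f, L2 f -> L2norm2 (V f) = L2norm2 f),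
      (forall g, L2 g -> exists f, L2 f /\ ae_eqc (V f) g) &
      (forall f g, L2 f -> L2 g -> forall z,
          wigner (V f) (V g) z = wigner f g (mxapp (invmx S) z))].

Definition metaplectic_lift d (Mc : 'M[R]_(d + d))
    (U : R -> ('rV[R]_d -> R[i]) -> ('rV[R]_d -> R[i])) : Prop :=
  [/\ (forall t, metaplectic (symp_flow Mc t) (U t)),
      (forall f, L2 f -> ae_eqc (U 0 f) f) &
      (forall f, L2 f -> forall t0 (eps : R), 0 < eps -> exists2 delta : R, 0 < delta &
          forall t, `|t - t0| < delta ->
            (L2norm2 (fun x => (U t f x - U t0 f x)%R) < (eps ^+ 2)%:E)%E)].

Definition posdef d (M : 'M[R]_d) : Prop :=
  M^T = M /\ forall x : 'rV[R]_d, x != 0 -> 0 < qform M x.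

End Defs.

(* Main.v *)
(** The metaplectic operator moves Wigner distributions by [S], so the Gaussian bound
    on [u t1] says that the Fourier transform in [t] of u0(x+t/2) conj(u0(x-t/2)),
    which is the Wigner distribution of [u0] at (x, xi), decays like
    exp(-2 pi N(Ax + B xi).(Ax + B xi)), while the bound on [u0] gives decay in [t]
    like exp(-pi/2 Mt.t). Let [v] be a left eigenvector of M B^T N B with eigenvalue
    [lam] and [w] = v M. Along the direction [w] these two decay rates are those of a
    one-dimensional function [k] with parameters 1/(2q) and 2 lam q, where q = Mv.v,
    and their product is lam > 1: Hardy's theorem applies in one variable.

    In Hardy's theorem the Gaussian Laplace transform z -> int k exp(-z pi r^2) of the
    even part of [k] is a power series in z for |z| < 1/(2q); by Gaussian
    subordination it is also z^(-1/2) times a power series in 1/z for |1/z| < 2 lam q.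
    As lam > 1, both converge on a common annulus. With z = y^2 and y = e^p this reads
    y A(y^2) = B(y^-2) for real p in an interval; continuing p to p + i pi changes y to
    -y, hence the sign of the left-hand side only, so both sides vanish. This holds for
    all [xi], and letting [xi] vary, uniqueness of the cosine transform in [t] gives
    u0(x) conj(u0(x)) = 0. *)
From HB Require Import structures.
Require Import Defs.
From mathcomp Require Import all_boot all_order all_algebra finmap.
From mathcomp Require Import all_classical all_reals all_analysis.
From mathcomp Require Import complex.
From mathcomp Require Import measurable_realfun ring lra.
Import Order.TTheory GRing.Theory Num.Theory.
Import numFieldNormedType.Exports.

Set Implicit Arguments.
Unset Strict Implicit.
Unset Printing Implicit Defensive.

Local Open Scope ring_scope.
Local Open Scope classical_set_scope.

(** The continuation is carried out on real integrals. A power series in y = e^p is an integral of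
    exp(lam p) over [nat] with the counting measure, lam running through the exponents; its value at
    p + i th is recorded by the two integrals with the extra factors cos(th lam) and sin(th lam).
    These factors are bounded by 1, so the same margin [eps] serves every vertical step, and
    finitely many steps reach th = pi. In the direction w the decay at time t1 is governed by N(Ax +
    B xi).(Ax + B xi), a quadratic with a linear term. Completing the square gives the cosine
    transform any exponent b < 2 lam q at the price of a constant, and lam > 1 leaves an open
    interval in which to choose z. A single z suffices: the weight exp(-z pi (w.t)^2) stays in front
    of u0(x+t/2) conj(u0(x-t/2)) and equals 1 at t = 0. The bound at time t1 holds almost everywhere
    and the Wigner distribution is an iterated integral. Hence a product measure on tuples is built,
    and its null sets are shown to pull back to null sets under t -> x + s t with s nonzero. *)

Section RealIntegrals.
Context d (T : measurableType d) (R : realType)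
        (mu : {measure set T -> \bar R}).
Implicit Types f g : T -> R.

(** * Real integrals and termwise integration of power series *)

Lemma measurable_integrable f :
  mu.-integrable setT (EFin \o f) -> measurable_fun setT f.
Proof. by move=> /measurable_int/measurable_EFinP. Qed.

Lemma le_integrable_real f g : measurable_fun setT f ->
  (forall x, `|f x| <= g x) -> mu.-integrable setT (EFin \o g) ->
  mu.-integrable setT (EFin \o f).
Proof.
move=> mf fg ig; apply: (le_integrable measurableT _ _ ig).
  exact/measurable_EFinP.
by move=> x _ /=; rewrite lee_fin (le_trans (fg x))// ler_norm.
Qed.

Lemma Rintegral_dominated_cvg (F : nat -> T -> R) f g :
  (forall n, measurable_fun setT (F n)) ->
  (forall x, F n x @[n --> \oo] --> f x) ->
  mu.-integrable setT (EFin \o g) ->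
  (forall n x, `|F n x| <= g x) ->
  (\int[mu]_x F n x) @[n --> \oo] --> \int[mu]_x f x.
Proof.
move=> mF Ff ig Fg.
have mf : measurable_fun setT f.
  by apply: (@measurable_fun_cvg _ _ _ _ F f) => // x _; exact: Ff.
have [| | | |//|iF _ cvg_int] := @dominated_convergence _ _ _ mu setT measurableT
    (fun n => EFin \o F n) (EFin \o f) (EFin \o g).
- by move=> n; exact/measurable_EFinP.
- exact/measurable_EFinP.
- by apply: aeW => x _; apply: cvg_EFin; [exact: nearW|exact: Ff].
- exact: ig.
- by apply: aeW => x n _ /=; rewrite lee_fin.
apply: fine_cvg; rewrite fineK; first exact: cvg_int.
exact: integrable_fin_num.
Qed.

Lemma integrableZ_real f (r : R) : mu.-integrable setT (EFin \o f) ->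
  mu.-integrable setT (EFin \o (fun x => r * f x)).
Proof. by move=> fi; exact: (integrableZl measurableT r fi). Qed.

Lemma integrable_sum_real n (F : nat -> T -> R) :
  (forall k, mu.-integrable setT (EFin \o F k)) ->
  mu.-integrable setT (EFin \o (fun x => \sum_(k < n) F k x)).
Proof.
move=> iF; elim: n => [|n IHn].
  apply: (eq_integrable measurableT (fun=> 0%E)) => [x _ /=|].
    by rewrite big_ord0.
  exact: integrable0.
apply: (eq_integrable measurableT
  ((EFin \o (fun x => \sum_(k < n) F k x)) \+ (EFin \o F n))) => [x _ /=|].
  by rewrite big_ord_recr.
exact: integrableD.
Qed.

Lemma Rintegral_sum n (F : nat -> T -> R) :
  (forall k, mu.-integrable setT (EFin \o F k)) ->
  \int[mu]_x (\sum_(k < n) F k x) = \sum_(k < n) \int[mu]_x F k x.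
Proof.
move=> iF; elim: n => [|n IHn].
  rewrite big_ord0; under eq_Rintegral do rewrite big_ord0.
  by rewrite Rintegral_cst// mul0r.
rewrite big_ord_recr -IHn /=; under eq_Rintegral do rewrite big_ord_recr/=.
by rewrite RintegralD//; exact: integrable_sum_real.
Qed.

Lemma series_exp_coeff_le (y : R) n :
  \sum_(k < n) `|y| ^+ k / k`!%:R <= expR `|y|.
Proof.
have cv := @is_cvg_series_exp_coeff R `|y|.
have := nondecreasing_cvgn_le _ cv n; rewrite /series/= big_mkord; apply.
by apply: nondecreasing_series => k _ _; exact: exp_coeff_ge0.
Qed.

(** One dominating function serves exp, cos and sin at once: with coefficients bounded by 1/k!,
    every partial sum at y is at most exp |y|. Single powers are integrable because |y|^k <= k! exp
    |y|. *)
Lemma Rintegral_power_series (gam : nat -> R) (E : R -> R) (u lam : T -> R) :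
  (forall k, `|gam k| <= (k`!%:R)^-1) ->
  (forall y, \sum_(k < n) gam k * y ^+ k @[n --> \oo] --> E y) ->
  measurable_fun setT u -> measurable_fun setT lam ->
  mu.-integrable setT (EFin \o (fun x => `|u x| * expR `|lam x|)) ->
  (forall k, mu.-integrable setT (EFin \o (fun x => u x * lam x ^+ k))) /\
  \sum_(k < n) gam k * (\int[mu]_x (u x * lam x ^+ k)) @[n --> \oo] -->
    \int[mu]_x (u x * E (lam x)).
Proof.
move=> hgam hE mu_ mlam iu.
have mpow k : measurable_fun setT (fun x => u x * lam x ^+ k).
  by apply: measurable_funM => //; exact: measurable_funX.
have ipow k : mu.-integrable setT (EFin \o (fun x => u x * lam x ^+ k)).
  apply: (@le_integrable_real _ (fun x => k`!%:R * (`|u x| * expR `|lam x|))).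
  - exact: mpow.
  - move=> x; rewrite normrM mulrCA ler_wpM2l// normrX.
    rewrite mulrC -ler_pdivrMr ?ltr0n ?fact_gt0//.
    apply: le_trans (series_exp_coeff_le (lam x) k.+1).
    rewrite big_ord_recr/= lerDr sumr_ge0//.
  - exact: integrableZ_real.
split => //.
have -> : (fun n => \sum_(k < n) gam k * (\int[mu]_x (u x * lam x ^+ k))) =
    (fun n => \int[mu]_x (\sum_(k < n) gam k * (u x * lam x ^+ k))).
  apply/funext => n.
  rewrite (@Rintegral_sum _ (fun k x => gam k * (u x * lam x ^+ k))) => [|k]; last first.
    exact: integrableZ_real.
  by apply: eq_bigr => k _; rewrite RintegralZl.
apply: (Rintegral_dominated_cvg
    (g := fun x => `|u x| * expR `|lam x|)) => //.
- move=> n.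
  have := @integrable_sum_real n (fun k x => gam k * (u x * lam x ^+ k)).
  by move=> /(_ (fun k => integrableZ_real _ (ipow k)))/measurable_integrable.
- move=> x; under eq_fun do under eq_bigr do rewrite mulrCA.
  under eq_fun do rewrite -mulr_sumr.
  exact: cvgMr.
- move=> n x; under eq_bigr do rewrite mulrCA.
  rewrite -mulr_sumr normrM ler_wpM2l//.
  apply: le_trans (series_exp_coeff_le (lam x) n).
  apply: le_trans (ler_norm_sum _ _ _) _; apply: ler_sum => k _.
  by rewrite normrM normrX mulrC ler_wpM2l// exprn_ge0.
Qed.

End RealIntegrals.

Section PowerSeries.
Context {R : realType}.
Implicit Types (a : nat -> R) (x : R).

Lemma expR_series x : \sum_(k < n) (k`!%:R)^-1 * x ^+ k @[n --> \oo] --> expR x.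
Proof.
have := @is_cvg_series_exp_coeff R x.
rewrite /expR /series/= exp_coeffE.
by under eq_fun do rewrite big_mkord.
Qed.

Lemma cos_series x : \sum_(k < n) ((~~ odd k)%:R * (-1) ^+ k./2 * (k`!%:R)^-1) * x ^+ k
  @[n --> \oo] --> cos x.
Proof.
have := @is_cvg_series_cos_coeff R x.
rewrite cos_coeffE => cv; rewrite cosE /pseries.
apply: cvg_trans cv; apply: near_eq_cvg; apply: nearW => n.
by rewrite /series/= big_mkord.
Qed.

Lemma sin_series x : \sum_(k < n) ((odd k)%:R * (-1) ^+ k.-1./2 * (k`!%:R)^-1) * x ^+ k
  @[n --> \oo] --> sin x.
Proof.
have := @is_cvg_series_sin_coeff R x.
rewrite sin_coeffE => cv; rewrite sinE /pseries.
apply: cvg_trans cv; apply: near_eq_cvg; apply: nearW => n.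
by rewrite /series/= big_mkord.
Qed.

Lemma normr_sign_fact (b : bool) m k :
  `|b%:R * (-1) ^+ m * (k`!%:R)^-1| <= (k`!%:R)^-1 :> R.
Proof.
rewrite !normrM normrX normrN1 expr1n mulr1 normfV.
rewrite [ `|k`!%:R|]ger0_norm// ler_piMl ?invr_ge0//.
by case: b; rewrite ?normr1 ?normr0.
Qed.

Lemma eqr_le_norm_inv k : `|(k`!%:R)^-1| <= (k`!%:R)^-1 :> R.
Proof. by rewrite ger0_norm ?invr_ge0. Qed.

(** Identity theorem. Once the earlier coefficients vanish, the partial sums at p are a_k p^k plus a
    tail dominated by a geometric series in p / p0, of order p^(k+1). So |a_k| is at most a constant
    times p for all small p > 0. *)
Lemma power_series_eq0 a (rho : R) : 0 < rho ->
  (forall p, `|p| < rho -> \sum_(k < n) a k * p ^+ k @[n --> \oo] --> 0) ->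
  forall k, a k = 0.
Proof.
move=> rho0 h; pose p0 := rho / 2.
have p0_gt0 : 0 < p0 by rewrite /p0; lra.
have p0rho : `|p0| < rho by rewrite gtr0_norm// /p0; lra.
have [C C0 hC] : exists2 C, 0 < C & forall k, `|a k| * p0 ^+ k <= C.
  have : cvgn (series (fun k => a k * p0 ^+ k)).
    apply/cvg_ex; exists 0; rewrite /series/=.
    by under eq_fun do rewrite big_mkord; exact: h.
  move/cvg_series_cvg_0 => cv0.
  have /cvg_seq_bounded/pinfty_ex_gt0 : cvgn (fun k => a k * p0 ^+ k).
    by apply/cvg_ex; exists 0.
  move=> [C C0 hC]; exists C => // k.
  by have /= := hC k I; rewrite normrM normrX (gtr0_norm p0_gt0).
elim/ltn_ind => k IHk; apply/eqP; rewrite -normr_le0.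
suff key : forall p, 0 < p -> p <= p0 / 2 -> `|a k| <= 2 * C / p0 ^+ k.+1 * p.
  apply/ler_addgt0Pr => e e0; rewrite add0r.
  pose D := 2 * C / p0 ^+ k.+1.
  have D0 : 0 < D by rewrite /D divr_gt0 ?mulr_gt0 ?exprn_gt0.
  have p0' : 0 < Num.min (p0 / 2) (e / D) by rewrite lt_min (divr_gt0 e0 D0) andbT; lra.
  apply: le_trans (key _ p0' _) _; first by rewrite ge_min lexx.
  rewrite -/D mulrC -ler_pdivlMr// ge_min lexx orbT//.
move=> p pgt0 pp0.
have prho : `|p| < rho by rewrite gtr0_norm//; move: pp0; rewrite /p0; lra.
have cv := h _ prho.
have q1 : p / p0 <= 2^-1 by rewrite ler_pdivrMr//; lra.
have q0 : 0 <= p / p0 by rewrite divr_ge0// ltW.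
have bnd n : `|\sum_(i < k.+1 + n) a i * p ^+ i - a k * p ^+ k| <=
    C * (p / p0) ^+ k.+1 * 2.
  rewrite big_split_ord/= big_ord_recr/= big1 ?add0r; last first.
    by move=> i _; rewrite IHk// mul0r.
  rewrite (addrC (a k * p ^+ k)) addrK.
  apply: le_trans (ler_norm_sum _ _ _) _.
  (* The geometric sum of ratio 1/2 is written with its remainder, which makes the bound 2 an
     equality provable by induction on [n]. *)
  have -> : C * (p / p0) ^+ k.+1 * 2 = \sum_(i < n) C * (p / p0) ^+ k.+1 * 2^-1 ^+ i
     + C * (p / p0) ^+ k.+1 * 2 * 2^-1 ^+ n.
    elim: n => [|n IHn]; first by rewrite big_ord0 add0r expr0 mulr1.
    rewrite [LHS]IHn big_ord_recr/= [2^-1 ^+ n.+1]exprS -addrA; congr (_ + _).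
    by set q := C * _; set t := _ ^+ n; lra.
  apply: ler_wpDr; first by rewrite !mulr_ge0 ?exprn_ge0 ?invr_ge0// ltW.
  apply: ler_sum => i _.
  rewrite normrM normrX (gtr0_norm pgt0).
  have -> : p ^+ (k.+1 + i) = p0 ^+ (k.+1 + i) * ((p / p0) ^+ k.+1 * (p / p0) ^+ i).
    rewrite -exprD -exprMn; congr (_ ^+ _); field; exact: lt0r_neq0.
  rewrite mulrA -[leRHS]mulrA; apply: ler_pM => //.
  - by rewrite mulr_ge0 ?exprn_ge0 ?(ltW p0_gt0).
  - by rewrite mulr_ge0 ?exprn_ge0.
  by rewrite ler_wpM2l ?exprn_ge0// lerXn2r// nnegrE invr_ge0.
have cv' : `|\sum_(i < k.+1 + n) a i * p ^+ i - a k * p ^+ k| @[n --> \oo] -->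
    `|0 - a k * p ^+ k|.
  apply: cvg_norm; apply: cvgB; last exact: cvg_cst.
  move: cv; rewrite -(cvg_shiftn k.+1); apply: cvg_trans; apply: near_eq_cvg.
  by apply: nearW => n /=; rewrite addnC.
have : `|0 - a k * p ^+ k| <= C * (p / p0) ^+ k.+1 * 2.
  rewrite -(cvg_lim _ cv')//; apply: limr_le; first by apply/cvg_ex; eexists; exact: cv'.
  by apply: nearW.
rewrite sub0r normrN normrM normrX (gtr0_norm pgt0).
rewrite -ler_pdivlMr ?exprn_gt0// => /le_trans; apply.
rewrite le_eqVlt; apply/orP; left; apply/eqP.
rewrite expr_div_n [p ^+ k.+1]exprS; field.
by rewrite !expf_neq0 ?lt0r_neq0.
Qed.

End PowerSeries.

(** * Exponential integrals on a strip and their analytic continuation *)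

Section ExponentialIntegral.
Context d (T : measurableType d) (R : realType)
        (mu : {measure set T -> \bar R}).

(** Integrability is asked only at the two ends of the strip widened by [eps]: in between, exp(lam
    x) is at most the sum of its end values. The margin [eps] is the length of expansion allowed
    around a point of the open strip. *)
Definition strip_integrable (u lam : T -> R) (y1 y2 eps : R) :=
  [/\ measurable_fun setT u, measurable_fun setT lam,
   mu.-integrable setT (EFin \o (fun t => `|u t| * expR (lam t * (y1 - eps)))) &
   mu.-integrable setT (EFin \o (fun t => `|u t| * expR (lam t * (y2 + eps))))].

(** According to the sign of [lam t], the factor exp |p lam t| is absorbed by one end of the widened
    strip. Allowing any v with |v| <= |u| covers u cos and u sin with the margin unchanged. *)
Lemma integrable_strip (u lam v : T -> R) (y1 y2 eps x p : R) :
  strip_integrable u lam y1 y2 eps -> measurable_fun setT v ->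
  (forall t, `|v t| <= `|u t|) -> y1 < x < y2 -> `|p| <= eps ->
  mu.-integrable setT
    (EFin \o (fun t => `|v t * expR (lam t * x)| * expR `|p * lam t|)).
Proof.
move=> [mu_ mlam int1 int2] mv vu /andP[y1x xy2] pe.
apply: (@le_integrable_real _ _ _ _ _ (fun t => `|u t| * expR (lam t * (y1 - eps)) +
    `|u t| * expR (lam t * (y2 + eps)))).
- apply: measurable_funM; apply: measurableT_comp => //.
    by apply: measurable_funM => //; apply: measurableT_comp => //; exact: measurable_funM.
  by apply: measurableT_comp => //; exact: measurable_funM.
- move=> t; rewrite normrM normr_id normrM (gtr0_norm (expR_gt0 _)) (gtr0_norm (expR_gt0 _)).
  rewrite -mulrA -mulrDr ler_pM ?mulr_ge0 ?expR_ge0// -expRD normrM.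
  have : `|p| * `|lam t| <= eps * `|lam t| by rewrite ler_wpM2r.
  case: (lerP 0 (lam t)) => l0; [rewrite (ger0_norm l0) => h|rewrite (ltr0_norm l0) => h].
    rewrite ler_wpDl ?expR_ge0// ler_expR.
    by have : 0 <= lam t * (y2 - x) by [rewrite mulr_ge0// subr_ge0 ltW|]; lra.
  rewrite ler_wpDr ?expR_ge0// ler_expR.
  by have : 0 <= - lam t * (x - y1) by [rewrite mulr_ge0 ?oppr_ge0 ?subr_ge0 ?ltW//|]; lra.
- have := integrableD measurableT int1 int2; exact.
Qed.

Lemma moments_series (u lam v : T -> R) (y1 y2 eps x p : R)
    (gam : nat -> R) (E : R -> R) :
  (forall k, `|gam k| <= (k`!%:R)^-1) ->
  (forall y, \sum_(k < n) gam k * y ^+ k @[n --> \oo] --> E y) ->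
  strip_integrable u lam y1 y2 eps -> measurable_fun setT v ->
  (forall t, `|v t| <= `|u t|) -> y1 < x < y2 -> `|p| <= eps ->
  \sum_(k < n) gam k * (\int[mu]_t (v t * expR (lam t * x) * lam t ^+ k)) * p ^+ k
    @[n --> \oo] --> \int[mu]_t (v t * expR (lam t * x) * E (p * lam t)).
Proof.
move=> hgam hE su mv vu xy pe; have [mu_ mlam _ _] := su.
have mvx : measurable_fun setT (fun t => v t * expR (lam t * x)).
  by apply: measurable_funM => //; apply: measurableT_comp => //; exact: measurable_funM.
have [ipow] := Rintegral_power_series hgam hE mvx
  (measurable_funM (measurable_cst p) mlam) (integrable_strip su mv vu xy pe).
apply: cvg_trans; apply: near_eq_cvg; apply: nearW => n; apply: eq_bigr => j _.
(* Integrability is known for the factor (p lam)^j and is divided by p^j before p^j leaves the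
   integral; j = 0 and p = 0 are settled apart. *)
have [-> | j0] := posnP j.
  by rewrite expr0 mulr1; congr (_ * _); apply: eq_Rintegral => t _; rewrite !expr0.
have [->|p0] := eqVneq p 0.
  rewrite expr0n eqn0Ngt j0 mulr0.
  under eq_Rintegral do rewrite /= mul0r expr0n eqn0Ngt j0 mulr0.
  by rewrite Rintegral_cst// mul0r mulr0.
rewrite -mulrA; congr (_ * _); rewrite mulrC -RintegralZl//.
  by apply: eq_Rintegral => t _; rewrite exprMn; ring.
have := integrableZ_real (p ^- j) (ipow j).
apply: eq_integrable => // t _ /=; congr EFin.
by rewrite exprMn; field; rewrite expf_neq0.
Qed.

End ExponentialIntegral.

Section AnalyticContinuation.
Context d1 (T1 : measurableType d1) d2 (T2 : measurableType d2) (R : realType)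
        (mu1 : {measure set T1 -> \bar R}) (mu2 : {measure set T2 -> \bar R}).
Variables (u1 l1 : T1 -> R) (u2 l2 : T2 -> R) (y1 y2 eps : R).
Hypothesis eps0 : 0 < eps.
Hypothesis su1 : strip_integrable mu1 u1 l1 y1 y2 eps.
Hypothesis su2 : strip_integrable mu2 u2 l2 y1 y2 eps.

Definition same_laplace (v1 : T1 -> R) (v2 : T2 -> R) :=
  forall x, y1 < x < y2 ->
    \int[mu1]_t (v1 t * expR (l1 t * x)) = \int[mu2]_t (v2 t * expR (l2 t * x)).

(* Expanding exp(lam p) around x turns the hypothesis into an equality of power
   series in p near 0. *)
Lemma same_laplace_moments (v1 : T1 -> R) (v2 : T2 -> R) : measurable_fun setT v1 -> measurable_fun setT v2 ->
  (forall t, `|v1 t| <= `|u1 t|) -> (forall t, `|v2 t| <= `|u2 t|) ->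
  same_laplace v1 v2 ->
  forall x k, y1 < x < y2 ->
    \int[mu1]_t (v1 t * expR (l1 t * x) * l1 t ^+ k) =
    \int[mu2]_t (v2 t * expR (l2 t * x) * l2 t ^+ k).
Proof.
move=> mv1 mv2 vu1 vu2 v12 x k xy.
pose rho := Num.min eps (Num.min (x - y1) (y2 - x)).
have rho0 : 0 < rho by rewrite /rho !lt_min eps0 !subr_gt0 xy.
pose M1 k := \int[mu1]_t (v1 t * expR (l1 t * x) * l1 t ^+ k).
pose M2 k := \int[mu2]_t (v2 t * expR (l2 t * x) * l2 t ^+ k).
suff M0 : forall k, (k`!%:R)^-1 * M1 k - (k`!%:R)^-1 * M2 k = 0.
  apply/eqP; rewrite -subr_eq0; move/eqP: (M0 k).
  rewrite -mulrBr mulf_eq0 invr_eq0 pnatr_eq0.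
  by rewrite -leqn0 leqNgt fact_gt0.
apply: (power_series_eq0 rho0) => p prho.
have [pe px py] : [/\ `|p| <= eps, `|p| < x - y1 & `|p| < y2 - x].
  by move: prho; rewrite /rho !lt_min => /and3P[/ltW].
have c1 := moments_series (@eqr_le_norm_inv R) (@expR_series R) su1 mv1 vu1 xy pe.
have c2 := moments_series (@eqr_le_norm_inv R) (@expR_series R) su2 mv2 vu2 xy pe.
have E0 : \int[mu1]_t (v1 t * expR (l1 t * x) * expR (p * l1 t)) -
          \int[mu2]_t (v2 t * expR (l2 t * x) * expR (p * l2 t)) = 0.
  have := v12 (x + p); move: px py; rewrite !ltr_norml => px py /(_ ltac:(lra)) h.
  apply/eqP; rewrite subr_eq0; apply/eqP.
  transitivity (\int[mu1]_t (v1 t * expR (l1 t * (x + p)))).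
    by apply: eq_Rintegral => t _; rewrite -mulrA -expRD mulrDr [p * _]mulrC.
  rewrite h.
  by apply: eq_Rintegral => t _; rewrite -mulrA -expRD mulrDr [p * _]mulrC.
rewrite (_ : (fun n => _) = (fun n => \sum_(k < n) (k`!%:R)^-1 * M1 k * p ^+ k -
    \sum_(k < n) (k`!%:R)^-1 * M2 k * p ^+ k)).
  by have := cvgB c1 c2; rewrite E0; exact.
by apply/funext => n; rewrite -sumrB; apply: eq_bigr => j _; ring.
Qed.

(** With E = cos or sin this displaces x in the imaginary direction: the moments at x agree, hence
    so does every series formed with them. *)
Lemma same_laplace_series (v1 : T1 -> R) (v2 : T2 -> R) (gam : nat -> R) (E : R -> R) (p : R) :
  (forall k, `|gam k| <= (k`!%:R)^-1) ->
  (forall y, \sum_(k < n) gam k * y ^+ k @[n --> \oo] --> E y) ->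
  measurable_fun setT v1 -> measurable_fun setT v2 ->
  (forall t, `|v1 t| <= `|u1 t|) -> (forall t, `|v2 t| <= `|u2 t|) ->
  same_laplace v1 v2 -> `|p| <= eps ->
  forall x, y1 < x < y2 ->
    \int[mu1]_t (v1 t * expR (l1 t * x) * E (p * l1 t)) =
    \int[mu2]_t (v2 t * expR (l2 t * x) * E (p * l2 t)).
Proof.
move=> hgam hE mv1 mv2 vu1 vu2 v12 pe x xy.
have c1 := moments_series hgam hE su1 mv1 vu1 xy pe.
have c2 := moments_series hgam hE su2 mv2 vu2 xy pe.
apply: (cvg_unique _ c1) => //; apply: cvg_trans c2; apply: near_eq_cvg.
apply: nearW => n; apply: eq_bigr => k _.
by rewrite (same_laplace_moments mv1 mv2).
Qed.

(** Equality of the real and imaginary parts of the two Laplace integrals at x + i th. Both parts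
    are carried along because the addition formulas mix them. *)
Definition same_laplace_at (th : R) :=
  same_laplace (fun t => u1 t * cos (th * l1 t)) (fun t => u2 t * cos (th * l2 t)) /\
  same_laplace (fun t => u1 t * sin (th * l1 t)) (fun t => u2 t * sin (th * l2 t)).

Lemma ler_norm_mul_cos (a b : R) : `|a * cos b| <= `|a|.
Proof. by rewrite normrM ler_piMr// cos_max. Qed.

Lemma ler_norm_mul_sin (a b : R) : `|a * sin b| <= `|a|.
Proof. by rewrite normrM ler_piMr// sin_max. Qed.

Lemma integrable_strip_mul d (T : measurableType d) (mu : {measure set T -> \bar R})
    (u l v : T -> R) (g : R -> R) (x p : R) :
  strip_integrable mu u l y1 y2 eps -> y1 < x < y2 ->
  measurable_fun setT v -> (forall t, `|v t| <= `|u t|) ->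
  measurable_fun setT g -> (forall y, `|g y| <= 1) ->
  mu.-integrable setT (EFin \o (fun t => v t * expR (l t * x) * g (p * l t))).
Proof.
move=> su xy mv vu mg g1; have [mu_ ml _ _] := su.
have e0 : `|0 : R| <= eps by rewrite normr0 ltW.
apply: le_integrable_real (integrable_strip su mv vu xy e0).
  apply: measurable_funM.
    by apply: measurable_funM => //; apply: measurableT_comp => //; exact: measurable_funM.
  by apply: measurableT_comp => //; exact: measurable_funM.
by move=> t; rewrite mul0r normr0 expR0 mulr1 normrM ler_piMr.
Qed.

(** The cosine and sine series applied to each part give four equalities, recombined by the addition
    formulas. The step bound [eps] does not depend on [th], since u cos and u sin are bounded by the
    same u. *)
Lemma same_laplace_at_add (th de : R) : same_laplace_at th -> `|de| <= eps ->
  same_laplace_at (th + de).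
Proof.
have [mu1_ ml1 _ _] := su1; have [mu2_ ml2 _ _] := su2.
have mC : measurable_fun setT (@cos R) by apply: continuous_measurable_fun; exact: continuous_cos.
have mS : measurable_fun setT (@sin R) by apply: continuous_measurable_fun; exact: continuous_sin.
have m1 (g : R -> R) : measurable_fun setT g -> measurable_fun setT (fun t => u1 t * g (th * l1 t)).
  by move=> mg; apply: measurable_funM => //; apply: measurableT_comp => //; exact: measurable_funM.
have m2 (g : R -> R) : measurable_fun setT g -> measurable_fun setT (fun t => u2 t * g (th * l2 t)).
  by move=> mg; apply: measurable_funM => //; apply: measurableT_comp => //; exact: measurable_funM.
have cos1 (y : R) : `|cos y| <= 1 by exact: cos_max.
have sin1 (y : R) : `|sin y| <= 1 by exact: sin_max.
move=> [hc hs] de0.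
have ser g1 g2 := (same_laplace_series (gam := g1) (E := g2)).
have kc : forall k, `|(~~ odd k)%:R * (-1) ^+ k./2 * (k`!%:R)^-1| <= (k`!%:R)^-1 :> R.
  by move=> k; exact: normr_sign_fact.
have ks : forall k, `|(odd k)%:R * (-1) ^+ k.-1./2 * (k`!%:R)^-1| <= (k`!%:R)^-1 :> R.
  by move=> k; exact: normr_sign_fact.
have cc := same_laplace_series kc (@cos_series R) (m1 _ mC) (m2 _ mC)
  (fun=> ler_norm_mul_cos _ _) (fun=> ler_norm_mul_cos _ _) hc de0.
have cs := same_laplace_series ks (@sin_series R) (m1 _ mC) (m2 _ mC)
  (fun=> ler_norm_mul_cos _ _) (fun=> ler_norm_mul_cos _ _) hc de0.
have sc := same_laplace_series kc (@cos_series R) (m1 _ mS) (m2 _ mS)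
  (fun=> ler_norm_mul_sin _ _) (fun=> ler_norm_mul_sin _ _) hs de0.
have ss := same_laplace_series ks (@sin_series R) (m1 _ mS) (m2 _ mS)
  (fun=> ler_norm_mul_sin _ _) (fun=> ler_norm_mul_sin _ _) hs de0.
split=> x xy.
- transitivity (\int[mu1]_t (u1 t * cos (th * l1 t) * expR (l1 t * x) * cos (de * l1 t)) -
    \int[mu1]_t (u1 t * sin (th * l1 t) * expR (l1 t * x) * sin (de * l1 t))).
    rewrite -RintegralB//; last 2 first.
    - exact: (integrable_strip_mul _ su1 xy (m1 _ mC) (fun=> ler_norm_mul_cos _ _) mC cos1).
    - exact: (integrable_strip_mul _ su1 xy (m1 _ mS) (fun=> ler_norm_mul_sin _ _) mS sin1).
    by apply: eq_Rintegral => t _; rewrite mulrDl cosD; ring.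
  rewrite cc// ss//.
  rewrite -RintegralB//; last 2 first.
  - exact: (integrable_strip_mul _ su2 xy (m2 _ mC) (fun=> ler_norm_mul_cos _ _) mC cos1).
  - exact: (integrable_strip_mul _ su2 xy (m2 _ mS) (fun=> ler_norm_mul_sin _ _) mS sin1).
  by apply: eq_Rintegral => t _; rewrite mulrDl cosD; ring.
- transitivity (\int[mu1]_t (u1 t * sin (th * l1 t) * expR (l1 t * x) * cos (de * l1 t)) +
    \int[mu1]_t (u1 t * cos (th * l1 t) * expR (l1 t * x) * sin (de * l1 t))).
    rewrite -RintegralD//; last 2 first.
    - exact: (integrable_strip_mul _ su1 xy (m1 _ mS) (fun=> ler_norm_mul_sin _ _) mC cos1).
    - exact: (integrable_strip_mul _ su1 xy (m1 _ mC) (fun=> ler_norm_mul_cos _ _) mS sin1).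
    by apply: eq_Rintegral => t _; rewrite mulrDl sinD; ring.
  rewrite sc// cs//.
  rewrite -RintegralD//; last 2 first.
  - exact: (integrable_strip_mul _ su2 xy (m2 _ mS) (fun=> ler_norm_mul_sin _ _) mC cos1).
  - exact: (integrable_strip_mul _ su2 xy (m2 _ mC) (fun=> ler_norm_mul_cos _ _) mS sin1).
  by apply: eq_Rintegral => t _; rewrite mulrDl sinD; ring.
Qed.

Lemma same_laplace_rotate (th : R) : same_laplace u1 u2 ->
  same_laplace (fun t => u1 t * cos (th * l1 t)) (fun t => u2 t * cos (th * l2 t)).
Proof.
move=> h.
have h0 : same_laplace_at 0.
  split=> x xy.
    under eq_Rintegral do rewrite mul0r cos0 mulr1.
    by under [RHS]eq_Rintegral do rewrite mul0r cos0 mulr1; exact: h.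
  under eq_Rintegral do rewrite mul0r sin0 mulr0 mul0r.
  under [RHS]eq_Rintegral do rewrite mul0r sin0 mulr0 mul0r.
  by rewrite !Rintegral_cst// !mul0r.
(* Enough steps for each to have length at most [eps]. *)
pose n := (Num.truncn (`|th| / eps)).+1.
have thn : `|th / n%:R| <= eps.
  rewrite normrM normfV (ger0_norm (ler0n _ _)) ler_pdivrMr ?ltr0n//.
  by rewrite mulrC -ler_pdivrMr// ltW// truncnS_gt// ger0_real// divr_ge0// ltW.
have : forall m, same_laplace_at (m%:R * (th / n%:R)).
  elim=> [|m IHm]; first by rewrite mul0r.
  by rewrite -natr1 mulrDl mul1r; exact: same_laplace_at_add.
by move=> /(_ n); rewrite mulrCA divff ?mulr1 ?pnatr_eq0// => -[].
Qed.

End AnalyticContinuation.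

(** * Gaussian integrals, moments and Fourier transform *)

Section Gaussian.
Context {R : realType}.
Notation leb := (@lebesgue_measure R).

(** The Gaussian is an unnormalised normal density of variance z / (2 pi), so its mass comes from
    that of a probability density. *)
Lemma gauss_normal_fun (m z s : R) : 0 < z ->
  expR (- (pi * (s - m) ^+ 2 / z)) = normal_fun m (Num.sqrt (z / (2 * pi))) s.
Proof.
move=> z0; rewrite /normal_fun; congr expR.
rewrite sqr_sqrtr; last by rewrite divr_ge0 ?mulr_ge0 ?pi_ge0// ltW.
rewrite -mulr_natr; move: (@pi R) (pi_gt0 R) => q q0.
by field; rewrite !lt0r_neq0.
Qed.

Lemma integrable_gauss (m z : R) : 0 < z ->
  leb.-integrable setT (EFin \o (fun s => expR (- (pi * (s - m) ^+ 2 / z)))).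
Proof.
move=> z0; pose sg := Num.sqrt (z / (2 * pi)).
have sg0 : sg != 0.
  by rewrite lt0r_neq0// sqrtr_gt0 divr_gt0 ?mulr_gt0 ?pi_gt0.
have := integrableZ_real (normal_peak sg)^-1 (integrable_normal_pdf m sg).
apply: eq_integrable => // s _ /=; congr EFin.
rewrite normal_pdfE// gauss_normal_fun// mulrA mulVf ?mul1r//.
by rewrite lt0r_neq0// normal_peak_gt0.
Qed.

Lemma Rintegral_gauss (m z : R) : 0 < z ->
  \int[leb]_s expR (- (pi * (s - m) ^+ 2 / z)) = Num.sqrt z.
Proof.
move=> z0; pose sg := Num.sqrt (z / (2 * pi)).
have sg0 : sg != 0.
  by rewrite lt0r_neq0// sqrtr_gt0 divr_gt0 ?mulr_gt0 ?pi_gt0.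
transitivity (\int[leb]_s ((normal_peak sg)^-1 * normal_pdf m sg s)).
  apply: eq_Rintegral => s _.
  rewrite normal_pdfE// gauss_normal_fun// mulrA mulVf ?mul1r//.
  by rewrite lt0r_neq0// normal_peak_gt0.
rewrite RintegralZl//; last exact: integrable_normal_pdf.
rewrite /Rintegral integral_normal_pdf mulr1 invrK /normal_peak; congr Num.sqrt.
rewrite /sg sqr_sqrtr; last by rewrite divr_ge0 ?mulr_ge0 ?pi_ge0// ltW.
rewrite -mulr_natr; move: (@pi R) (pi_gt0 R) => q q0.
by field; rewrite lt0r_neq0.
Qed.

Lemma integrable_gauss0 (a : R) : 0 < a ->
  leb.-integrable setT (EFin \o (fun s => expR (- (a * s ^+ 2)))).
Proof.
move=> a0; have z0 : 0 < pi / a by rewrite divr_gt0// pi_gt0.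
have := integrable_gauss 0 z0.
apply: eq_integrable => // s _ /=; congr (EFin (expR _)).
rewrite subr0; move: (@pi R) (pi_gt0 R) => q q0.
by field; rewrite !lt0r_neq0.
Qed.

Lemma sum_even (g : nat -> R) n :
  \sum_(k < n) (if odd k then 0 else g k./2) = \sum_(j < uphalf n) g j.
Proof.
elim: n => [|n IHn]; first by rewrite !big_ord0.
rewrite big_ord_recr/= IHn uphalfE/= uphalf_half.
by case: (odd n); rewrite ?addr0// add0n big_ord_recr.
Qed.

Lemma cvg_sum_even (g : nat -> R) (l : R) :
  \sum_(j < n) g j @[n --> \oo] --> l ->
  \sum_(k < n) (if odd k then 0 else g k./2) @[n --> \oo] --> l.
Proof.
move=> h; under eq_fun do rewrite sum_even.
apply: (cvg_comp _ _ _ h) => A [N _ hN]; exists N.*2 => // n/= Nn; apply: hN => /=.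
by rewrite -(half_double N) uphalf_half (leq_trans (half_leq Nn))// leq_addl.
Qed.

Lemma gauss_exp_measurable (z : R) :
  measurable_fun setT (fun s : R => expR (- (pi * s ^+ 2 / z))).
Proof.
apply: continuous_measurable_fun => s.
apply: (cvg_comp (fun s : R => - (pi * s ^+ 2 / z)) expR); last exact: continuous_expR.
apply: cvgN; apply: cvgM; last exact: cvg_cst.
by apply: cvgM; [exact: cvg_cst|exact: exprn_continuous].
Qed.

Lemma linear_measurable (p : R) : measurable_fun setT (fun s : R => p * (2 * pi * s)).
Proof.
apply: continuous_measurable_fun => s.
by apply: cvgM; [exact: cvg_cst|apply: cvgM; [exact: cvg_cst|exact: cvg_id]].
Qed.

Definition gauss_moment (z : R) k : R := 
  \int[leb]_s (expR (- (pi * s ^+ 2 / z)) * (2 * pi * s) ^+ k).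

(** Since exp |y| <= exp y + exp (-y), completing the square bounds the product by two Gaussians
    centred at z p and -z p, with the factor exp(pi z p^2). *)
Lemma integrable_gauss_exp (z p : R) : 0 < z ->
  leb.-integrable setT
    (EFin \o (fun s => `|expR (- (pi * s ^+ 2 / z))| * expR `|p * (2 * pi * s)|)).
Proof.
move=> z0.
apply: (@le_integrable_real _ (measurableTypeR R) R leb _ (fun s : R =>
   expR (pi * z * p ^+ 2) * expR (- (pi * (s - z * p) ^+ 2 / z)) +
   expR (pi * z * p ^+ 2) * expR (- (pi * (s - - (z * p)) ^+ 2 / z)))).
- have m1 := gauss_exp_measurable z; have m2 := linear_measurable p.
  have m : measurable_fun setT (fun s : R =>
      `|expR (- (pi * s ^+ 2 / z))| * expR `|p * (2 * pi * s)|).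
    by apply: measurable_funM; apply: measurableT_comp => //; exact: measurableT_comp.
  exact: m.
- move=> s; rewrite normrM normr_id !(gtr0_norm (expR_gt0 _)).
  have e (q : R) : expR (pi * z * q ^+ 2) * expR (- (pi * (s - z * q) ^+ 2 / z)) =
      expR (- (pi * s ^+ 2 / z)) * expR (q * (2 * pi * s)).
    by rewrite -!expRD; congr expR; field; exact: lt0r_neq0.
  have := e (- p); rewrite sqrrN mulrN => ->; rewrite e -mulrDr.
  rewrite ler_wpM2l ?expR_ge0//.
  case: (lerP 0 (p * (2 * pi * s))) => h.
    by rewrite (ger0_norm h) lerDl expR_ge0.
  by rewrite (ltr0_norm h) mulNr lerDr expR_ge0.
- have := integrableD measurableT
    (integrableZ_real (expR (pi * z * p ^+ 2)) (integrable_gauss (z * p) z0))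
    (integrableZ_real (expR (pi * z * p ^+ 2)) (integrable_gauss (- (z * p)) z0)).
  exact.
Qed.

Lemma gauss_moment_series (z p : R) (gam : nat -> R) (E : R -> R) : 0 < z ->
  (forall k, `|gam k| <= (k`!%:R)^-1) ->
  (forall y, \sum_(k < n) gam k * y ^+ k @[n --> \oo] --> E y) ->
  \sum_(k < n) gam k * gauss_moment z k * p ^+ k @[n --> \oo] -->
  \int[leb]_s (expR (- (pi * s ^+ 2 / z)) * E (p * (2 * pi * s))).
Proof.
move=> z0 hgam hE.
have [_] := @Rintegral_power_series _ (measurableTypeR R) R leb _ _ _ _ hgam hE (gauss_exp_measurable z)
  (linear_measurable p) (integrable_gauss_exp p z0).
apply: cvg_trans; apply: near_eq_cvg; apply: nearW => n; apply: eq_bigr => k _.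
rewrite -[RHS]mulrA; congr (_ * _).
transitivity (\int[leb]_s (p ^+ k * (expR (- (pi * s ^+ 2 / z)) * (2 * pi * s) ^+ k))); last first.
  rewrite RintegralZl//; first exact: mulrC.
  have [+ _] := @Rintegral_power_series _ (measurableTypeR R) R leb _ _ _ _ hgam hE
    (gauss_exp_measurable z) (linear_measurable 1) (integrable_gauss_exp 1 z0).
  by move=> /(_ k); apply: eq_integrable => // s _ /=; rewrite mul1r.
by apply: eq_Rintegral => s _; rewrite exprMn; ring.
Qed.

(** The generating function is explicit: by completing the square, the integral of exp(-pi s^2/z)
    exp(2 pi s p) is sqrt(z) exp(pi z p^2). The identity theorem then compares coefficients. *)
Lemma gauss_momentE (z : R) k : 0 < z ->
  (k`!%:R)^-1 * gauss_moment z k =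
  if odd k then 0 else Num.sqrt z * (((k./2)`!%:R)^-1 * (pi * z) ^+ k./2).
Proof.
move=> z0; apply/eqP; rewrite -subr_eq0; apply/eqP; move: k.
apply: (@power_series_eq0 _ _ 1) => // p _.
have c1 := gauss_moment_series (p := p) z0 (@eqr_le_norm_inv R) (@expR_series R).
have e1 : \int[leb]_s (expR (- (pi * s ^+ 2 / z)) * expR (p * (2 * pi * s))) =
    Num.sqrt z * expR (pi * z * p ^+ 2).
  transitivity (\int[leb]_s (expR (pi * z * p ^+ 2) *
      expR (- (pi * (s - z * p) ^+ 2 / z)))); last first.
    by rewrite RintegralZl ?Rintegral_gauss 1?mulrC//; exact: integrable_gauss.
  by apply: eq_Rintegral => s _; rewrite -!expRD; congr expR; field; exact: lt0r_neq0.
rewrite e1 in c1.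
rewrite (_ : (fun n => _) = (fun n => \sum_(k < n) (k`!%:R)^-1 * gauss_moment z k * p ^+ k -
    \sum_(k < n) (if odd k then 0 else Num.sqrt z * (((k./2)`!%:R)^-1 * (pi * z * p ^+ 2) ^+ k./2)))).
  rewrite -[X in _ --> X](subrr (Num.sqrt z * expR (pi * z * p ^+ 2))).
  apply: cvgB; first exact: c1.
  apply: (cvg_sum_even (g := fun j => Num.sqrt z * ((j`!%:R)^-1 * (pi * z * p ^+ 2) ^+ j))).
  by under eq_fun do rewrite -mulr_sumr; apply: cvgMr; exact: expR_series.
apply/funext => n; rewrite -sumrB; apply: eq_bigr => k _; rewrite mulrBl; congr (_ - _).
have [ok|ek] := boolP (odd k); first by rewrite mul0r.
have -> : p ^+ k = (p ^+ 2) ^+ k./2 by rewrite -exprM mul2n even_halfK.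
by rewrite [in RHS]exprMn; ring.
Qed.

(** The explicit moments, inserted in the cosine series, sum to sqrt(z) times the series of exp(-pi
    z r^2). *)
Lemma Rintegral_gauss_cos (z r : R) : 0 < z ->
  \int[leb]_s (expR (- (pi * s ^+ 2 / z)) * cos (2 * pi * s * r)) =
  Num.sqrt z * expR (- (pi * z * r ^+ 2)).
Proof.
move=> z0.
have kc : forall k, `|(~~ odd k)%:R * (-1) ^+ k./2 * (k`!%:R)^-1| <= (k`!%:R)^-1 :> R.
  by move=> k; exact: normr_sign_fact.
have c1 := gauss_moment_series (p := r) z0 kc (@cos_series R).
transitivity (\int[leb]_s (expR (- (pi * s ^+ 2 / z)) * cos (r * (2 * pi * s)))).
  by apply: eq_Rintegral => s _; rewrite [r * _]mulrC.
apply: (cvg_unique _ c1) => //.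
rewrite (_ : (fun n => _) = (fun n => \sum_(k < n) (if odd k then 0 else
    Num.sqrt z * (((k./2)`!%:R)^-1 * (- (pi * z * r ^+ 2)) ^+ k./2)))).
  apply: (cvg_sum_even (g := fun j => Num.sqrt z * ((j`!%:R)^-1 * (- (pi * z * r ^+ 2)) ^+ j))).
  under eq_fun do rewrite -mulr_sumr.
  by apply: cvgMr; exact: expR_series.
apply/funext => n; apply: eq_bigr => k _.
rewrite -[_ * _ * _ * gauss_moment z k]mulrA gauss_momentE//.
have [ok|ek] := boolP (odd k); first by rewrite mulr0 mul0r.
have -> : r ^+ k = (r ^+ 2) ^+ k./2 by rewrite -exprM mul2n even_halfK.
have -> : (- (pi * z * r ^+ 2)) ^+ k./2 = (-1) ^+ k./2 * ((pi * z) ^+ k./2 * (r ^+ 2) ^+ k./2).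
  by rewrite -(mulN1r (pi * z * r ^+ 2)) (exprMn _ (-1)) (exprMn _ (pi * z)).
by rewrite /=; ring.
Qed.

End Gaussian.

(** * Series as integrals for the counting measure *)

Section Counting.
Context {R : realType}.
Notation count := (@counting nat R).

Lemma counting_set1 (j : nat) : count [set j] = 1%E.
Proof.
have f1 : finite_set [set j] by exact: finite_set1.
by rewrite /counting asboolT// fset_set1 cardfs1.
Qed.

Lemma counting_integrable (c : nat -> R) C : (forall n, \sum_(k < n) `|c k| <= C) ->
  count.-integrable setT (EFin \o c).
Proof.
move=> hC; apply/integrableP; split; first exact/measurable_EFinP.
rewrite ge0_integral_count//.
apply: (@le_lt_trans _ _ C%:E); last exact: ltry.
apply: lime_le; first exact: is_cvg_nneseries.
by apply: nearW => n; rewrite /= sumEFin lee_fin big_mkord.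
Qed.

(** Lets the continuation lemmas, stated for measures, apply to power series. The truncations are
    finite sums of indicators of points, dominated by |c|. *)
Lemma counting_series (c : nat -> R) C : (forall n, \sum_(k < n) `|c k| <= C) ->
  \sum_(k < n) c k @[n --> \oo] --> \int[count]_k c k.
Proof.
move=> hC; have ic := counting_integrable hC.
pose F n k := if (k < n)%N then c k else 0.
have FE n : \int[count]_k F n k = \sum_(k < n) c k.
  transitivity (\int[count]_k (\sum_(j < n) c j * \1_[set (j : nat)] k)).
    apply: eq_Rintegral => k _; rewrite /F; case: ltnP => kn.
      rewrite (bigD1 (Ordinal kn))//= indicE mem_set// mulr1 big1 ?addr0// => j jk.
      rewrite indicE memNset ?mulr0//= => kj; move/eqP: jk; apply.
      by apply/val_inj; rewrite /= kj.
    rewrite big1// => j _; rewrite indicE memNset ?mulr0//= => kj.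
    by have := ltn_ord j; rewrite -kj ltnNge kn.
  have i1 j : count.-integrable setT (EFin \o (\1_[set j] : nat -> R)).
    apply/integrableP; split; first by apply/measurable_EFinP.
    under eq_integral do rewrite /= ger0_norm//.
    rewrite integral_indic// setIT.
    by rewrite [X in (X < _)%E]counting_set1 ltry.
  rewrite (@Rintegral_sum _ _ R count n (fun j k => c j * \1_[set j] k)); last first.
    by move=> j; exact: integrableZ_real.
  apply: eq_bigr => j _; rewrite RintegralZl//.
  rewrite /Rintegral integral_indic// setIT.
  by rewrite [X in fine X]counting_set1 mulr1.
under eq_fun do rewrite -FE.
apply: (@Rintegral_dominated_cvg _ nat R count _ _ (fun k => `|c k|)).
- by [].
- move=> k; apply: cvg_near_cst; exists k.+1 => // n /= kn.
  by rewrite /F kn.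
- exact: integrable_norm.
- by move=> n k; rewrite /F; case: ifP => // _; rewrite normr0.
Qed.

End Counting.

(** * Taylor expansion of a Laplace transform *)

Section LaplaceSeries.
Context d (T : measurableType d) (R : realType)
        (mu : {measure set T -> \bar R}).
Variables (g q : T -> R) (A : R).
Hypotheses (mg : measurable_fun setT g) (mq : measurable_fun setT q).
Hypotheses (q0 : forall t, 0 <= q t) (A0 : 0 < A).
Hypothesis ig : mu.-integrable setT (EFin \o (fun t => `|g t| * expR (A * q t))).

Definition laplace_coef m : R := (m`!%:R)^-1 * \int[mu]_t (g t * (- q t) ^+ m).

Let mqz (z : R) : measurable_fun setT (fun t => - (z * q t)).
Proof. by apply: measurableT_comp => //; exact: measurable_funM. Qed.

Let igz (z : R) : 0 <= z <= A ->
  mu.-integrable setT (EFin \o (fun t => `|g t| * expR `|- (z * q t)|)).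
Proof.
move=> /andP[z0 zA]; apply: le_integrable_real ig.
  apply: measurable_funM; apply: measurableT_comp => //.
  by apply: measurableT_comp => //; exact: mqz.
move=> t; rewrite normrM normr_id (gtr0_norm (expR_gt0 _)) ler_wpM2l// ler_expR.
by rewrite normrN normrM (ger0_norm z0) (ger0_norm (q0 t)) ler_wpM2r.
Qed.

Lemma integrable_pow_laplace m :
  mu.-integrable setT (EFin \o (fun t => g t * (- q t) ^+ m)).
Proof.
have AA : 0 <= A <= A by rewrite lexx ltW.
have [+ _] := Rintegral_power_series (@eqr_le_norm_inv R) (@expR_series R) mg (mqz A) (igz AA).
move=> /(_ m) /(integrableZ_real (A ^- m)); apply: eq_integrable => // t _ /=; congr EFin.
rewrite -mulrN exprMn; field; by rewrite expf_neq0// lt0r_neq0.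
Qed.

Lemma laplace_series (z : R) : 0 <= z <= A ->
  \sum_(m < n) laplace_coef m * z ^+ m @[n --> \oo] --> \int[mu]_t (g t * expR (- (z * q t))).
Proof.
move=> zA.
have [_] := Rintegral_power_series (@eqr_le_norm_inv R) (@expR_series R) mg (mqz z) (igz zA).
apply: cvg_trans; apply: near_eq_cvg; apply: nearW => n; apply: eq_bigr => m _.
rewrite /laplace_coef -mulrA; congr (_ * _).
rewrite -RintegralZr//; last exact: integrable_pow_laplace.
by apply: eq_Rintegral => t _; rewrite -mulrN exprMn; ring.
Qed.

(** Summing under the integral, the terms (A q)^m / m! add up to at most exp(A q). The bound is
    independent of [n], which makes the coefficients, weighted by A^m, integrable for the counting
    measure. *)
Lemma laplace_coef_summable n :
  \sum_(m < n) `|laplace_coef m| * A ^+ m <= \int[mu]_t (`|g t| * expR (A * q t)).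
Proof.
have ipow m : mu.-integrable setT (EFin \o (fun t => (m`!%:R)^-1 * A ^+ m * `|g t * (- q t) ^+ m|)).
  by apply: integrableZ_real; apply: integrable_norm; exact: integrable_pow_laplace.
apply: (@le_trans _ _ (\int[mu]_t (\sum_(m < n) (m`!%:R)^-1 * A ^+ m * `|g t * (- q t) ^+ m|))).
  rewrite (@Rintegral_sum _ _ R mu n (fun m t => (m`!%:R)^-1 * A ^+ m * `|g t * (- q t) ^+ m|))//.
  apply: ler_sum => m _.
  rewrite RintegralZl//; last by apply: integrable_norm; exact: integrable_pow_laplace.
  rewrite /laplace_coef normrM (ger0_norm (_ : 0 <= (m`!%:R)^-1)) ?invr_ge0//.
  rewrite -!mulrA ler_wpM2l ?invr_ge0// mulrC ler_wpM2l ?exprn_ge0 ?(ltW A0)//.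
  by apply: le_normr_Rintegral => //; exact: integrable_pow_laplace.
apply: le_Rintegral => //.
  exact: (@integrable_sum_real _ _ R mu n (fun m t => (m`!%:R)^-1 * A ^+ m * `|g t * (- q t) ^+ m|)).
move=> t _.
have := series_exp_coeff_le (A * q t) n.
rewrite (ger0_norm (mulr_ge0 (ltW A0) (q0 t))) => h.
apply: le_trans (ler_wpM2l (normr_ge0 (g t)) h).
rewrite mulr_sumr le_eqVlt; apply/orP; left; apply/eqP; apply: eq_bigr => m _.
by rewrite normrM normrX normrN (ger0_norm (q0 t)) exprMn; ring.
Qed.

End LaplaceSeries.

(** * Cosine transform along r and Gaussian subordination *)

Section Hardy.
Context d (T : measurableType d) (R : realType)
        (mu : {sigma_finite_measure set T -> \bar R}).
Notation leb := (@lebesgue_measure R).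
Variables (k r : T -> R).
Hypotheses (mk : measurable_fun setT k) (mr : measurable_fun setT r).

Definition cos_transform (s : R) : R := \int[mu]_t (k t * cos (2 * pi * s * r t)).

Let kernel (z : R) (p : measurableTypeR R * T) : R :=
  k p.2 * cos (2 * pi * p.1 * r p.2) * expR (- (pi * p.1 ^+ 2 / z)).

Let measurable_cos : measurable_fun setT (@cos R).
Proof. by apply: continuous_measurable_fun; exact: continuous_cos. Qed.

Let measurable_kernel z : measurable_fun setT (kernel z).
Proof.
have m1 : measurable_fun setT (fun p : measurableTypeR R * T => p.1 : R).
  exact: (@measurable_fst _ _ (measurableTypeR R) T).
have m2 : measurable_fun setT (fun p : measurableTypeR R * T => p.2 : T) by exact: measurable_snd.
apply: measurable_funM; first apply: measurable_funM.
- exact: measurableT_comp.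
- apply: (measurableT_comp measurable_cos); apply: measurable_funM; last exact: measurableT_comp.
  by apply: measurable_funM.
- exact: (measurableT_comp (gauss_exp_measurable z) m1).
Qed.

Hypothesis ik : mu.-integrable setT (EFin \o k).

Let integrable_kernel z : 0 < z ->
  (leb \x mu)%E.-integrable setT (EFin \o kernel z).
Proof.
move=> z0; apply/integrable12ltyP; first exact/measurable_EFinP.
have /integrableP[_ ikfin] := ik.
pose K := (\int[mu]_t `|k t|%:E)%E.
have K0 : (0 <= K)%E by apply: integral_ge0 => t _; rewrite lee_fin.
apply: (@le_lt_trans _ _ (\int[leb]_s ((expR (- (pi * s ^+ 2 / z)))%:E * K))%E).
  apply: ge0_le_integral => //.
  - by move=> s _; apply: integral_ge0 => t _; rewrite abse_ge0.
  - apply: (measurable_fun_fubini_tonelli_F (abse \o (EFin \o kernel z))) => [|p]; last exact: abse_ge0.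
    by apply: measurableT_comp => //; exact/measurable_EFinP.
  - apply: emeasurable_funM => //; apply/measurable_EFinP; exact: gauss_exp_measurable.
  move=> s _.
  have -> : ((expR (- (pi * s ^+ 2 / z)))%:E * K =
      \int[mu]_t ((expR (- (pi * s ^+ 2 / z)))%:E * `|k t|%:E))%E.
    rewrite ge0_integralZl ?lee_fin ?expR_ge0//.
    by apply/measurable_EFinP; exact: measurableT_comp.
  apply: ge0_le_integral => //.
  - apply: measurableT_comp => //; apply/measurable_EFinP.
    exact: (measurableT_comp (measurable_kernel z) (pair1_measurable (s : measurableTypeR R))).
  - by apply: emeasurable_funM => //; apply/measurable_EFinP; exact: measurableT_comp.
  move=> t _; rewrite -EFinM lee_fin /kernel /= normrM mulrC (gtr0_norm (expR_gt0 _)).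
  by rewrite ler_wpM2l ?expR_ge0// ler_norm_mul_cos.
have Kfin : K \is a fin_num by rewrite ge0_fin_numE.
rewrite -(fineK Kfin); under eq_integral do rewrite muleC.
have := integrableZ_real (fine K) (integrable_gauss 0 z0).
move=> /integrableP[_]; apply: le_lt_trans.
rewrite le_eqVlt; apply/orP; left; apply/eqP; apply: eq_integral => s _ /=.
by rewrite subr0 -EFinM ger0_norm// mulr_ge0 ?expR_ge0 ?fine_ge0.
Qed.

Lemma measurable_cos_transform : measurable_fun setT cos_transform.
Proof.
have z1 : (0 : R) < 1 by [].
have mF := measurable_fubini_F (integrable_kernel z1).
(* Fubini gives measurability of the transform multiplied by exp(-pi s^2); the inverse factor
   restores the transform. *)
pose h s := expR (pi * s ^+ 2 / 1) * fine (fubini_F mu (EFin \o kernel 1) s).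
suff -> : cos_transform = h.
  apply: measurable_funM.
    apply: continuous_measurable_fun => s.
    apply: (cvg_comp (fun s : R => (pi * s ^+ 2 / 1)) expR); last exact: continuous_expR.
    apply: cvgM; last exact: cvg_cst.
    by apply: cvgM; [exact: cvg_cst|exact: exprn_continuous].
  exact: (measurableT_comp (@fine_measurable R _ _) mF).
apply/funext => s; rewrite /h /cos_transform.
have is_ : mu.-integrable setT (EFin \o (fun t => k t * cos (2 * pi * s * r t))).
  apply: le_integrable_real (integrable_norm ik).
    apply: measurable_funM => //; apply: (measurableT_comp measurable_cos).
    by apply: measurable_funM.
  by move=> t; exact: ler_norm_mul_cos.
have -> : fine (fubini_F mu (EFin \o kernel 1) s) =
    \int[mu]_t (k t * cos (2 * pi * s * r t) * expR (- (pi * s ^+ 2 / 1))) by [].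
by rewrite RintegralZr// mulrCA -expRD subrr expR0 mulr1.
Qed.

(** Fubini and the Fourier transform of a Gaussian: the parameter 1/z on the side of s becomes z on
    the side of r. This is what links the expansions in z and in 1/z. *)
Lemma cos_transform_gauss (z : R) : 0 < z ->
  \int[leb]_s (cos_transform s * expR (- (pi * s ^+ 2 / z))) =
  Num.sqrt z * \int[mu]_t (k t * expR (- (z * (pi * r t ^+ 2)))).
Proof.
move=> z0; have /Fubini := integrable_kernel z0; rewrite /kernel /= => F.
have icos s : mu.-integrable setT (EFin \o (fun t => k t * cos (2 * pi * s * r t))).
  apply: le_integrable_real (integrable_norm ik).
    apply: measurable_funM => //; apply: (measurableT_comp measurable_cos).
    by apply: measurable_funM.
  by move=> t; exact: ler_norm_mul_cos.
have iexp : mu.-integrable setT (EFin \o (fun t => k t * expR (- (z * (pi * r t ^+ 2))))).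
  apply: le_integrable_real (integrable_norm ik).
    apply: measurable_funM => //; apply: measurableT_comp => //.
    apply: measurableT_comp => //; apply: measurable_funM => //.
    by apply: measurable_funM => //; exact: measurable_funX.
  move=> t; rewrite normrM ler_piMr// gtr0_norm ?expR_gt0// -[leRHS]expR0 ler_expR.
  by rewrite oppr_le0 mulr_ge0 ?(ltW z0)// mulr_ge0 ?pi_ge0 ?sqr_ge0.
rewrite -RintegralZl//.
transitivity (fine (\int[leb]_s (\int[mu]_t
    (k t * cos (2 * pi * s * r t) * expR (- (pi * s ^+ 2 / z)))%:E))%E).
  congr fine; apply: eq_integral => s _.
  rewrite /cos_transform -RintegralZr// /Rintegral fineK//.
  by apply: integrable_fin_num => //; apply: (@integrableZr _ _ _ _ _ _ (expR _) _ (icos s)).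
rewrite F; congr fine; apply: eq_integral => t _.
have ig : leb.-integrable setT (EFin \o (fun s =>
    expR (- (pi * s ^+ 2 / z)) * cos (2 * pi * s * r t))).
  have := integrable_gauss 0 z0.
  apply: le_integrable_real.
    have m : measurable_fun setT (fun s : R => expR (- (pi * s ^+ 2 / z)) * cos (2 * pi * s * r t)).
      apply: measurable_funM; first exact: gauss_exp_measurable.
      by apply: (measurableT_comp measurable_cos); do 2 apply: measurable_funM => //.
    exact: m.
  by move=> s; rewrite subr0 -[leRHS]gtr0_norm ?expR_gt0// ler_norm_mul_cos.
transitivity ((\int[leb]_s (k t * (expR (- (pi * s ^+ 2 / z)) * cos (2 * pi * s * r t)))%R)%:E).
  rewrite /Rintegral fineK//.
    by apply: eq_integral => s _; congr EFin; ring.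
  by apply: integrable_fin_num => //; exact: integrableZ_real.
rewrite RintegralZl// Rintegral_gauss_cos//; congr EFin.
by rewrite mulrCA; congr (_ * (_ * expR _)); ring.
Qed.

End Hardy.

(** * Hardy's theorem for the Gaussian Laplace transform *)

Section HardyTheorem.
Context d (T : measurableType d) (R : realType)
        (mu : {sigma_finite_measure set T -> \bar R}).
Notation leb := (@lebesgue_measure R).
Notation count := (@counting nat R).

(** The shape a w^m is that of exp(l m * x) for [l] affine in m, as met when y = exp x is put in y
    A(y^2) and B(y^-2). *)
Lemma Rintegral_counting_geometric (c : nat -> R) (C A w : R) (L : R) (a : R) :
  0 < A -> (forall n, \sum_(m < n) `|c m| * A ^+ m <= C) -> 0 <= w <= A ->
  \sum_(m < n) c m * w ^+ m @[n --> \oo] --> L ->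
  \int[count]_m (c m * (a * w ^+ m)) = a * L.
Proof.
move=> A0 hC /andP[w0 wA] hL.
have bnd n : \sum_(m < n) `|c m * (a * w ^+ m)| <= `|a| * C.
  apply: le_trans (ler_wpM2l (normr_ge0 a) (hC n)).
  rewrite mulr_sumr; apply: ler_sum => m _.
  rewrite !normrM normrX (ger0_norm w0) mulrCA ler_wpM2l// ler_wpM2l//.
  by apply: lerXn2r => //; rewrite nnegrE// ltW.
apply: (cvg_unique _ (counting_series bnd)) => //.
rewrite (_ : (fun n => _) = (fun n => a * \sum_(m < n) c m * w ^+ m)).
  exact: cvgMr.
by apply/funext => n; rewrite mulr_sumr; apply: eq_bigr => m _; ring.
Qed.

Lemma integrable_counting_geometric (c : nat -> R) (C A w : R) (a : R) :
  0 < A -> (forall n, \sum_(m < n) `|c m| * A ^+ m <= C) -> 0 <= w <= A ->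
  count.-integrable setT (EFin \o (fun m => `|c m| * (a * w ^+ m))).
Proof.
move=> A0 hC /andP[w0 wA]; apply: (@counting_integrable _ _ (`|a| * C)) => n.
apply: le_trans (ler_wpM2l (normr_ge0 a) (hC n)).
rewrite mulr_sumr; apply: ler_sum => m _.
rewrite !normrM normr_id normrX (ger0_norm w0) mulrCA ler_wpM2l// ler_wpM2l//.
by apply: lerXn2r => //; rewrite nnegrE// ltW.
Qed.

Lemma expR_pow (x : R) m : expR (m%:R * x) = expR x ^+ m.
Proof. by rewrite expRM_natl. Qed.

Variables (k r : T -> R) (a b C : R).
Hypotheses (mk : measurable_fun setT k) (mr : measurable_fun setT r).
Hypotheses (a0 : 0 < a) (b0 : 0 < b).
Hypothesis ik : mu.-integrable setT (EFin \o (fun t => `|k t| * expR (a * (pi * r t ^+ 2)))).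
Hypothesis decay : forall s, `|cos_transform mu k r s| <= C * expR (- (b * (pi * s ^+ 2))).

(* Both Laplace transforms are power series, in y^2 for A and in y^-2 for B, and
   y A(y^2) = B(y^-2) on a real interval by [cos_transform_gauss].  Continuing y
   along the half circle to -y changes the sign of the left-hand side only. *)
Lemma hardy_laplace_eq0 (z : R) : b^-1 < z < a ->
  \int[mu]_t (k t * expR (- (z * (pi * r t ^+ 2)))) = 0.
Proof.
move=> /andP[bz za].
have z0 : 0 < z by apply: lt_trans bz; rewrite invr_gt0.
pose f := cos_transform mu k r.
(* Strictly below b, so that the transform times exp(b' pi s^2) is integrable; strictly above 1/z,
   so that the series in 1/z converges around that point. *)
pose b' := (z^-1 + b) / 2.
have zb : z^-1 < b by rewrite -(invrK b) ltf_pV2 ?posrE ?invr_gt0.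
have zi0 : 0 < z^-1 by rewrite invr_gt0.
have [zb' b'b] : z^-1 < b' /\ b' < b by rewrite /b'; lra.
have b'0 : 0 < b' by rewrite /b'; lra.
have mq : measurable_fun setT (fun t => pi * r t ^+ 2).
  by apply: measurable_funM => //; exact: measurable_funX.
have q0 t : 0 <= pi * r t ^+ 2 by rewrite mulr_ge0 ?pi_ge0 ?sqr_ge0.
have ik0 : mu.-integrable setT (EFin \o k).
  apply: le_integrable_real ik => // t.
  by rewrite ler_peMr// -[leLHS]expR0 ler_expR mulr_ge0// ltW.
have mf : measurable_fun (setT : set (measurableTypeR R)) f.
  exact: (measurable_cos_transform mk mr ik0).
have mqs : measurable_fun (setT : set (measurableTypeR R)) (fun s : R => pi * s ^+ 2).
  have m : measurable_fun setT (fun s : R => pi * s ^+ 2).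
    by apply: measurable_funM => //; exact: measurable_funX.
  exact: m.
have qs0 (s : measurableTypeR R) : 0 <= pi * s ^+ 2 by rewrite mulr_ge0 ?pi_ge0 ?sqr_ge0.
have iff : leb.-integrable setT (EFin \o (fun s => `|f s| * expR (b' * (pi * s ^+ 2)))).
  have e0 : 0 < (b - b') * pi by rewrite mulr_gt0 ?pi_gt0// subr_gt0.
  have := integrableZ_real C (integrable_gauss0 e0).
  apply: le_integrable_real.
    apply: measurable_funM; apply: measurableT_comp => //.
    by apply: measurable_funM.
  move=> s; rewrite normrM normr_id (gtr0_norm (expR_gt0 _)).
  apply: le_trans (ler_wpM2r (expR_ge0 _) (decay s)) _.
  by rewrite -[leLHS]mulrA -expRD le_eqVlt; apply/orP; left; apply/eqP; congr (_ * expR _); ring.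
pose ca := laplace_coef mu k (fun t => pi * r t ^+ 2).
pose cb := @laplace_coef _ (measurableTypeR R) R leb f (fun s => pi * s ^+ 2).
have sa := laplace_series mk mq q0 a0 ik.
have sb := laplace_series mf mqs qs0 b'0 iff.
have ba := laplace_coef_summable mk mq q0 a0 ik.
have bb := laplace_coef_summable mf mqs qs0 b'0 iff.
rewrite -/ca in sa ba; rewrite -/cb in sb bb.
(* In the variable p with z = exp(2 p), the given z sits at x0. Dividing by 4 keeps exp(2 p) <= a
   and exp(-2 p) <= b' up to distance 2 eps from x0: one [eps] for the strip, one for its margin. *)
pose x0 := ln z / 2.
pose eps := Num.min (ln (a / z)) (ln (b' * z)) / 4.
have eps0 : 0 < eps.
  rewrite /eps divr_gt0// lt_min !ln_gt0// ?ltr_pdivlMr ?mul1r//.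
  by rewrite -ltr_pdivrMr// div1r.
have bnd x : x0 - eps - eps <= x <= x0 + eps + eps ->
    expR (2 * x) <= a /\ expR (- (2 * x)) <= b'.
  move=> /andP[x1 x2].
  have ea : eps * 4 <= ln (a / z) by rewrite /eps divfK// ge_min lexx.
  have eb : eps * 4 <= ln (b' * z) by rewrite /eps divfK// ge_min lexx orbT.
  have [la lz lb] : [/\ expR (ln a) = a, expR (ln z) = z & expR (ln b') = b'].
    by split; rewrite lnK// posrE.
  rewrite ln_div ?posrE// in ea; rewrite lnM ?posrE// in eb.
  split.
    by rewrite -la ler_expR; move: x2; rewrite /x0; lra.
  by rewrite -lb ler_expR; move: x1; rewrite /x0; lra.
(* The exponents of y in y A(y^2) and in B(y^-2), for y = exp p. *)
pose l1 (m : nat) : R := 1 + m%:R * 2.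
pose l2 (m : nat) : R := m%:R * - 2.
have el1 m x : expR (l1 m * x) = expR x * expR (2 * x) ^+ m.
  by rewrite -expR_pow -expRD /l1; congr expR; ring.
have el2 m x : expR (l2 m * x) = 1 * expR (- (2 * x)) ^+ m.
  by rewrite -expR_pow mul1r /l2; congr expR; ring.
have su1 : strip_integrable count ca l1 (x0 - eps) (x0 + eps) eps.
  have i1 x : x0 - eps - eps <= x <= x0 + eps + eps ->
      count.-integrable setT (EFin \o (fun m => `|ca m| * expR (l1 m * x))).
    move=> /bnd[xa _]; under eq_fun do rewrite el1.
    apply: (integrable_counting_geometric (expR x) a0 ba).
    by rewrite expR_ge0.
  by split => //; apply: i1; lra.
have su2 : strip_integrable count cb l2 (x0 - eps) (x0 + eps) eps.
  have i1 x : x0 - eps - eps <= x <= x0 + eps + eps ->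
      count.-integrable setT (EFin \o (fun m => `|cb m| * expR (l2 m * x))).
    move=> /bnd[_ xb]; under eq_fun do rewrite el2.
    apply: (integrable_counting_geometric 1 b'0 bb).
    by rewrite expR_ge0.
  by split => //; apply: i1; lra.
have val1 x : x0 - eps < x < x0 + eps -> \int[count]_m (ca m * expR (l1 m * x)) =
    expR x * \int[mu]_t (k t * expR (- (expR (2 * x) * (pi * r t ^+ 2)))).
  move=> xx; have [xa _] : expR (2 * x) <= a /\ expR (- (2 * x)) <= b' by apply: bnd; lra.
  under eq_Rintegral do rewrite el1.
  apply: (Rintegral_counting_geometric _ a0 ba); first by rewrite expR_ge0.
  by apply: sa; rewrite expR_ge0.
have val2 x : x0 - eps < x < x0 + eps -> \int[count]_m (cb m * expR (l2 m * x)) =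
    \int[leb]_s (f s * expR (- (expR (- (2 * x)) * (pi * s ^+ 2)))).
  move=> xx; have [_ xb] : expR (2 * x) <= a /\ expR (- (2 * x)) <= b' by apply: bnd; lra.
  under eq_Rintegral do rewrite el2.
  rewrite -[RHS]mul1r.
  apply: (Rintegral_counting_geometric _ b'0 bb); first by rewrite expR_ge0.
  by apply: sb; rewrite expR_ge0.
have same : same_laplace count count l1 l2 (x0 - eps) (x0 + eps) ca cb.
  move=> x xx; rewrite val1// val2//.
  have := cos_transform_gauss mk mr ik0 (expR_gt0 (2 * x)).
  have -> : Num.sqrt (expR (2 * x)) = expR x.
    have -> : expR (2 * x) = expR x ^+ 2 by rewrite -expR_pow.
    by rewrite sqrtr_sqr ger0_norm ?expR_ge0.
  move=> <-; apply: eq_Rintegral => s _; rewrite (expRN (2 * x)).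
  by congr (_ * expR _); field; rewrite lt0r_neq0 ?expR_gt0.
(* At height pi the odd exponents [l1] give cosine -1 and the even exponents [l2] give cosine 1. *)
have := same_laplace_rotate eps0 su1 su2 pi same.
have xx : x0 - eps < x0 < x0 + eps by lra.
move=> /(_ _ xx).
have cos2 (m : nat) : cos (pi * (m%:R * 2)) = 1 :> R.
  elim: m => [|m IHm]; first by rewrite mul0r mulr0 cos0.
  have -> : pi * (m.+1%:R * 2) = pi * (m%:R * 2) + pi *+ 2 :> R.
    by rewrite -natr1 -[pi *+ 2]mulr_natr; ring.
  by rewrite cosD2pi.
have -> : \int[count]_m (cb m * cos (pi * l2 m) * expR (l2 m * x0)) =
    \int[count]_m (cb m * expR (l2 m * x0)).
  by apply: eq_Rintegral => m _; rewrite {1}/l2 mulrN mulrN cosN cos2 mulr1.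
rewrite -same//.
have -> : \int[count]_m (ca m * cos (pi * l1 m) * expR (l1 m * x0)) =
    - 1 * \int[count]_m (ca m * expR (l1 m * x0)).
  rewrite -RintegralZl//; last first.
    have [xa _] : expR (2 * x0) <= a /\ expR (- (2 * x0)) <= b' by apply: bnd; lra.
    have := integrable_counting_geometric (expR x0) a0 ba (w := expR (2 * x0)).
    rewrite expR_ge0 xa => /(_ isT); apply: le_integrable_real => // m.
    by rewrite normrM el1 [X in _ * X]ger0_norm ?mulr_ge0 ?exprn_ge0 ?expR_ge0.
  by apply: eq_Rintegral => m _; rewrite {1}/l1 mulrDr mulr1 addrC cosDpi cos2; ring.
rewrite val1// mulN1r => /eqP; rewrite -subr_eq0 -opprD oppr_eq0 -mulr2n mulrn_eq0/=.
rewrite mulf_eq0 gt_eqF ?expR_gt0//= => /eqP.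
suff -> : expR (2 * x0) = z by [].
by rewrite /x0 mulrC divfK// lnK// posrE.
Qed.

End HardyTheorem.

(** * Lebesgue measure on tuples and the iterated integrals *)

Lemma product_sigma_finite d1 d2 (T1 : measurableType d1) (T2 : measurableType d2)
    (R : realType) (m1 : {sigma_finite_measure set T1 -> \bar R})
    (m2 : {sigma_finite_measure set T2 -> \bar R}) : sigma_finite setT (m1 \x m2)%E.
Proof.
have [F FT hF] := sigma_finiteT m1; have [G GT hG] := sigma_finiteT m2.
exists (fun i : nat => let p : nat * nat := odflt (0, 0)%N (choice.unpickle i) in F p.1 `*` G p.2).
  rewrite -setXTT FT GT; apply/seteqP; split => [[x y] [[n _ Fx] [k _ Gy]]|[x y] [i _ []]].
    by exists (choice.pickle (n, k)) => //; rewrite choice.pickleK.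
  by split; [exists (odflt (0, 0)%N (choice.unpickle i)).1|exists (odflt (0, 0)%N (choice.unpickle i)).2].
move=> i /=; set p := odflt _ _.
have [mF Foo] := hF p.1; have [mG Goo] := hG p.2.
split; first exact: measurableX.
by rewrite product_measure1E// lte_mul_pinfty// ge0_fin_numE.
Qed.

Section ConsMeasure.
Context {R : realType} (n : nat).
Notation leb := (@lebesgue_measure R).

Definition tuple_cons (p : measurableTypeR R * n.-tuple R) : n.+1.-tuple R :=
  [tuple of (p.1 : R) :: p.2].

Lemma measurable_tuple_cons : measurable_fun setT tuple_cons.
Proof.
apply: (@measurable_cons _ _ (measurableTypeR R * n.-tuple R)%type R fst n snd).
  exact: (@measurable_fst _ _ (measurableTypeR R) (n.-tuple R)).
exact: measurable_snd.
Qed.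

HB.instance Definition _ := isMeasurableFun.Build _ _ _ _ tuple_cons measurable_tuple_cons.

Definition tuple_uncons (t : n.+1.-tuple R) : measurableTypeR R * n.-tuple R :=
  (thead t, [tuple of behead t]).

Lemma measurable_tuple_uncons : measurable_fun setT tuple_uncons.
Proof.
apply/measurable_fun_pairP; split.
  exact: (@measurable_tnth _ R n.+1 ord0).
exact: measurable_behead.
Qed.

Lemma tuple_consK : cancel tuple_cons tuple_uncons.
Proof. by move=> [a t]; congr pair; exact/val_inj. Qed.

Variable m : {sigma_finite_measure set (n.-tuple R) -> \bar R}.

Definition cons_measure := pushforward (leb \x m)%E tuple_cons.

Let pm : {measure set (n.+1.-tuple R) -> \bar R} :=
  measure_function_pushforward__canonical__measure_function_Measure
    (leb \x m)%E measurable_tuple_cons.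

HB.instance Definition _ := @isMeasure.Build _ _ _ cons_measure
  (measure0 pm) (measure_ge0 pm) (@measure_semi_sigma_additive _ _ _ pm).

Lemma cons_measure_sigma_finite : sigma_finite setT cons_measure.
Proof.
have [F FT hF] := product_sigma_finite leb m.
exists (fun i => tuple_uncons @^-1` F i).
  by rewrite -preimage_bigcup -FT preimage_setT.
move=> i; have [mF Foo] := hF i; split.
  by rewrite -[X in measurable X]setTI; exact: measurable_tuple_uncons.
rewrite /cons_measure /pushforward -comp_preimage.
rewrite (_ : _ \o _ = id); first by [].
by apply/funext => p /=; rewrite tuple_consK.
Qed.

HB.instance Definition _ :=
  Measure_isSigmaFinite.Build _ _ _ cons_measure cons_measure_sigma_finite.

Definition cons_sigma_finite : {sigma_finite_measure set (n.+1.-tuple R) -> \bar R} :=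
  cons_measure.

End ConsMeasure.

Section TupleMeasure.
Context {R : realType}.
Notation leb := (@lebesgue_measure R).

(** The recursion follows [Rd_int_nn] and [Rd_int]; the Dirac mass at the empty tuple matches
    evaluation at 0 in dimension 0. Iterated integrals thus become one integral, open to Fubini and
    dominated convergence. *)
Fixpoint tuple_measure n : {sigma_finite_measure set (n.-tuple R) -> \bar R} :=
  match n with
  | 0 => \d_ ([tuple] : 0.-tuple R)
  | n'.+1 => cons_sigma_finite (tuple_measure n')
  end.

Lemma row_of_tuple_cons n (a : R) (t : n.-tuple R) :
  row_of_tuple [tuple of a :: t] = vcons a (row_of_tuple t).
Proof.
apply/rowP => i; rewrite !mxE; case: unliftP => [j ->|->].
  by rewrite mxE tnthS.
by rewrite tnth0.
Qed.

Lemma ge0_integral_tuple_cons n (f : n.+1.-tuple R -> \bar R) :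
  measurable_fun setT f -> (forall t, 0 <= f t)%E ->
  (\int[tuple_measure n.+1]_t f t =
   \int[leb]_a \int[tuple_measure n]_t f [tuple of a :: t])%E.
Proof.
move=> mf f0.
rewrite [LHS](@ge0_integral_pushforward _ _ _ _ R (@tuple_cons R n) (@measurable_tuple_cons R n)
   (leb \x tuple_measure n)%E setT f)//.
rewrite preimage_setT fubini_tonelli1// => [|p]; last exact: f0.
by apply: measurableT_comp => //; exact: measurable_tuple_cons.
Qed.

Lemma Rd_int_nnE n (F : 'rV[R]_n -> \bar R) :
  measurable_fun setT (F \o @row_of_tuple R n) -> (forall x, 0 <= F x)%E ->
  Rd_int_nn F = (\int[tuple_measure n]_t F (row_of_tuple t))%E.
Proof.
elim: n F => [|n IHn] F mF F0.
  rewrite /= integral_dirac//= diracT mul1e.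
  by congr F; apply/rowP => -[].
rewrite ge0_integral_tuple_cons//=; apply: eq_integral => a _.
under eq_integral do rewrite row_of_tuple_cons.
apply: (IHn (fun y => F (vcons a y))) => //.
have := measurableT_comp mF (measurable_tuple_cons (n := n)).
move=> /measurableT_comp/(_ (pair1_measurable (a : measurableTypeR R))).
by congr (measurable_fun _ _); apply/funext => t; rewrite /= row_of_tuple_cons.
Qed.

(** In [Rd_intE] the inner iterated integral is identified with an integral for almost every first
    coordinate only, so its measurability must be known without integrability. The parameter space T
    absorbs the coordinates already fixed, which lets the induction run. *)
Lemma measurable_Rd_int d (T : measurableType d) n (F : T -> 'rV[R]_n -> R) :
  measurable_fun setT (fun p : T * n.-tuple R => F p.1 (row_of_tuple p.2)) ->
  measurable_fun setT (fun x => Rd_int (F x)).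
Proof.
elim: n d T F => [|n IHn] d T F mF.
  rewrite /=.
  have e x : F x 0 = F x (row_of_tuple [tuple]) by congr F; apply/rowP => -[].
  under eq_fun do rewrite e.
  by apply: (measurableT_comp mF (g := fun x => (x, [tuple]))).
pose G (p : T * measurableTypeR R) := Rd_int (fun y => F p.1 (vcons (p.2 : R) y)).
have mG : measurable_fun setT G.
  apply: (IHn _ (T * measurableTypeR R)%type (fun p y => F p.1 (vcons (p.2 : R) y))).
  have -> : (fun p : T * measurableTypeR R * n.-tuple R =>
      F p.1.1 (vcons (p.1.2 : R) (row_of_tuple p.2))) =
    (fun p : T * n.+1.-tuple R => F p.1 (row_of_tuple p.2)) \o
      (fun p : T * measurableTypeR R * n.-tuple R => (p.1.1, tuple_cons (p.1.2, p.2))).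
    by apply/funext => p; rewrite /= row_of_tuple_cons.
  apply: measurableT_comp => //.
  have m1 := @measurable_fst _ _ (T * measurableTypeR R)%type (n.-tuple R).
  have m11 := measurableT_comp (@measurable_fst _ _ T (measurableTypeR R)) m1.
  have m12 := measurableT_comp (@measurable_snd _ _ T (measurableTypeR R)) m1.
  have m2 := @measurable_snd _ _ (T * measurableTypeR R)%type (n.-tuple R).
  apply: (measurable_fun_pair m11).
  exact: (measurableT_comp (@measurable_tuple_cons R n) (measurable_fun_pair m12 m2)).
have -> : (fun x => Rd_int (F x)) = (fun x => fine (\int[leb]_a (G (x, a))%:E)) by [].
apply: (measurableT_comp (@fine_measurable R setT measurableT)).
have -> : (fun x => \int[leb]_a (G (x, a))%:E)%E =
    (fun x => \int[leb]_a ((EFin \o G)^\+ (x, a)) - \int[leb]_a ((EFin \o G)^\- (x, a)))%E.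
  apply/funext => x; rewrite integralE.
  by congr (_ - _)%E; apply: eq_integral => a _; rewrite ?funeposE ?funenegE.
apply: emeasurable_funB.
  apply: (@measurable_fun_fubini_tonelli_F _ _ T (measurableTypeR R) R leb (EFin \o G)^\+%E) => //.
  by apply: measurable_funepos; exact/measurable_EFinP.
apply: (@measurable_fun_fubini_tonelli_F _ _ T (measurableTypeR R) R leb (EFin \o G)^\-%E) => //.
by apply: measurable_funeneg; exact/measurable_EFinP.
Qed.

Lemma Rd_intE n (F : 'rV[R]_n -> R) :
  (tuple_measure n).-integrable setT (EFin \o F \o @row_of_tuple R n) ->
  Rd_int F = \int[tuple_measure n]_t F (row_of_tuple t).
Proof.
elim: n F => [|n IHn] F iF.
  rewrite /= /Rintegral integral_dirac//= ?diracT ?mul1e.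
    by rewrite indicE in_setT mul1r; congr F; apply/rowP => -[].
  exact: measurable_int iF.
have mF : measurable_fun setT (EFin \o F \o @row_of_tuple R n.+1).
  exact: measurable_int iF.
pose H (p : measurableTypeR R * n.-tuple R) := (F (row_of_tuple (tuple_cons p)))%:E.
have mH : measurable_fun setT H.
  exact: (measurableT_comp mF (measurable_tuple_cons (n := n))).
have iH : (leb \x tuple_measure n)%E.-integrable setT H.
  apply/integrableP; split => //.
  have /integrableP[_] := iF.
  rewrite [X in (X < _)%E](@ge0_integral_pushforward _ _ _ _ R (@tuple_cons R n)
    (@measurable_tuple_cons R n) (leb \x tuple_measure n)%E setT)//.
  exact: measurableT_comp.
have HE a t : H (a, t) = (F (vcons a (row_of_tuple t)))%:E.
  by rewrite /H /tuple_cons row_of_tuple_cons.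
transitivity (fine (\int[leb]_a \int[tuple_measure n]_t H (a, t))%E); last first.
  congr fine; rewrite (integral12_prod_meas1 iH).
  rewrite [RHS](@integral_pushforward _ _ _ _ R (@tuple_cons R n)
    (@measurable_tuple_cons R n) (leb \x tuple_measure n)%E setT)//.
rewrite /= /Rintegral; congr fine; apply: ae_eq_integral => //.
- apply/measurable_EFinP.
  apply: (@measurable_Rd_int _ (measurableTypeR R) n (fun a y => F (vcons a y))).
  move/measurable_EFinP: mH; congr (measurable_fun _ _); apply/funext => -[a t].
  by rewrite /tuple_cons row_of_tuple_cons.
- exact: (measurable_fubini_F iH).
have := ae_integrable1 iH; apply: filterS => a ia _.
have ia' : (tuple_measure n).-integrable setT
    (EFin \o (fun y => F (vcons (a : R) y)) \o @row_of_tuple R n).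
  by apply: eq_integrable ia => // t _; rewrite HE.
rewrite (IHn _ ia') /Rintegral fineK.
  by apply: eq_integral => t _; rewrite HE.
exact: integrable_fin_num.
Qed.

End TupleMeasure.

(** * Null sets under affine maps, and positivity of cubes *)

Section NullSets.
Context {R : realType}.
Notation leb := (@lebesgue_measure R).

Lemma affine_preimage_itv (x s a b : R) : 0 < s ->
  (fun r : R => x + s * r) @^-1` `]a, b] = `](a - x) / s, (b - x) / s]%classic.
Proof.
move=> s0; apply/seteqP; split => r /=; rewrite !in_itv/= ltr_pdivrMr// ler_pdivlMr// => /andP[ar rb];
  apply/andP; split; lra.
Qed.

Lemma affine_measurable (x s : R) : measurable_fun setT (fun r : R => x + s * r).
Proof. by apply: measurable_funD => //; exact: measurable_funM. Qed.

(** The push-forward of Lebesgue measure by r -> x + s r, multiplied by s, agrees with Lebesgue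
    measure on half-open intervals, hence on all measurable sets. *)
Lemma lebesgue_null_affine_pos (x s : R) (A : set (measurableTypeR R)) : 0 < s ->
  measurable A -> leb A = 0%E ->
  leb ((fun r : R => x + s * r) @^-1` A : set (measurableTypeR R)) = 0%E.
Proof.
move=> s0 mA A0.
have mf : measurable_fun (setT : set (measurableTypeR R))
    (fun r => x + s * r : measurableTypeR R) by exact: affine_measurable.
pose nu : {measure set (measurableTypeR R) -> \bar R} :=
  measure_function_pushforward__canonical__measure_function_Measure leb mf.
pose nus := mscale (NngNum (ltW s0)) nu.
have e : forall X, measurable X -> leb X = nus X.
  apply: lebesgue_measure_unique => _ [[a b]] _ <-.
  transitivity (s%:E * leb ((fun r : R => (x + s * r)%R) @^-1` `]a, b] :
    set (measurableTypeR R)))%E; last by [].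
  rewrite (affine_preimage_itv x a b s0).
  rewrite !lebesgue_measure_itv/= !lte_fin ltr_pM2r ?invr_gt0// ltrD2r.
  case: ifPn => ab; last by rewrite mule0.
  by rewrite -!EFinB -EFinM; congr EFin; field; exact: lt0r_neq0.
have : nus A = 0%E by rewrite -e.
by rewrite /nus /mscale /= => /eqP; rewrite mule_eq0 eqe gt_eqF//= => /eqP.
Qed.

Lemma lebesgue_null_affine (x s : R) (A : set (measurableTypeR R)) : s != 0 ->
  measurable A -> leb A = 0%E ->
  leb ((fun r : R => x + s * r) @^-1` A : set (measurableTypeR R)) = 0%E.
Proof.
move=> s0 mA A0; have [s_gt0|s_lt0|s_eq0] := ltgtP 0 s.
- exact: lebesgue_null_affine_pos.
- rewrite -lebesgue_measureN.
    rewrite /pushforward -comp_preimage.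
    rewrite (_ : _ \o _ = (fun r : R => x + (- s) * r)); last first.
      by apply/funext => r /=; rewrite mulrN mulNr.
    by apply: lebesgue_null_affine_pos => //; rewrite oppr_gt0.
  rewrite -[X in measurable X]setTI.
  have mf : measurable_fun (setT : set (measurableTypeR R))
    (fun r => x + s * r : measurableTypeR R) by exact: affine_measurable.
  exact: mf.
- by move: s0; rewrite -s_eq0 eqxx.
Qed.

Definition tuple_affine n (x : 'rV[R]_n) (s : R) (t : n.-tuple R) : n.-tuple R :=
  [tuple x 0 i + s * tnth t i | i < n].

Lemma row_of_tuple_affine n (x : 'rV[R]_n) s t :
  row_of_tuple (tuple_affine x s t) = x + s *: row_of_tuple t.
Proof. by apply/rowP => i; rewrite !mxE tnth_mktuple. Qed.

Lemma measurable_tuple_affine n (x : 'rV[R]_n) s :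
  measurable_fun setT (tuple_affine x s).
Proof.
apply/measurable_fun_tnthP => i.
rewrite (_ : _ \o _ = (fun t : n.-tuple R => x 0 i + s * tnth t i)); last first.
  by apply/funext => t /=; rewrite tnth_mktuple.
apply: measurable_funD => //; apply: measurable_funM => //.
exact: measurable_tnth.
Qed.

Lemma tuple_affine_cons n (x : 'rV[R]_n.+1) s (a : R) (t : n.-tuple R) :
  tuple_affine x s [tuple of a :: t] =
  [tuple of (x 0 0 + s * a) :: tuple_affine (\row_i x 0 (lift ord0 i)) s t].
Proof.
apply: eq_from_tnth => i; rewrite tnth_mktuple.
case: (unliftP ord0 i) => [j ->|->]; last by rewrite !tnth0.
by rewrite !tnthS tnth_mktuple mxE.
Qed.

Lemma tuple_measureS n (A : set (n.+1.-tuple R)) : 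
  tuple_measure n.+1 A =
  (\int[leb]_a (tuple_measure n ((fun t : n.-tuple R => [tuple of a :: t]) @^-1` A)))%E.
Proof.
rewrite [LHS]/= /cons_measure /pushforward /product_measure1.
apply: eq_integral => a _ /=; congr (tuple_measure n _).
by apply/seteqP; split => t; rewrite /xsection /= inE.
Qed.

Lemma measurable_section n (A : set (n.+1.-tuple R)) : measurable A ->
  measurable_fun (setT : set (measurableTypeR R)) (fun a : R =>
    tuple_measure n ((fun t : n.-tuple R => [tuple of a :: t]) @^-1` A)).
Proof.
move=> mA.
have mA' : measurable (@tuple_cons R n @^-1` A).
  by rewrite -[X in measurable X]setTI; exact: measurable_tuple_cons.
have := measurable_fun_xsection (tuple_measure n) mA'.
congr (measurable_fun _ _); apply/funext => a /=; congr (tuple_measure n _).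
by apply/seteqP; split => t; rewrite /xsection /= inE.
Qed.

(** Transports an almost everywhere bound to the points x + t/2 and x - t/2 for almost every t.
    Almost all sections of a null set are null, and the exceptional set of first coordinates is
    moved by an affine map of the line. *)
Lemma tuple_measure_null_affine n (x : 'rV[R]_n) s (A : set (n.-tuple R)) : s != 0 ->
  measurable A -> tuple_measure n A = 0%E ->
  tuple_measure n (tuple_affine x s @^-1` A) = 0%E.
Proof.
move=> s0; elim: n x A => [|n IHn] x A mA A0.
  rewrite (_ : _ @^-1` A = A)//; apply/seteqP.
  by split => t /=; rewrite (tuple0 t) (tuple0 (tuple_affine _ _ _)).
have mpre : measurable (tuple_affine x s @^-1` A).
  by rewrite -[X in measurable X]setTI; exact: measurable_tuple_affine.
pose m a := tuple_measure n ((fun t : n.-tuple R => [tuple of a :: t]) @^-1` A).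
have mm : measurable_fun (setT : set (measurableTypeR R)) m by exact: measurable_section.
have m0 : ae_eq leb setT m (cst 0%E).
  apply/ae_eq_integral_abs => //.
  under eq_integral do rewrite gee0_abs//.
  by rewrite -tuple_measureS.
have [N [mN N0 hN]] := m0.
rewrite tuple_measureS.
transitivity (\int[leb]_a (cst 0 a : \bar R))%E; last by rewrite integral0.
apply: ae_eq_integral => //; first exact: measurable_section.
exists ((fun r : R => x 0 0 + s * r) @^-1` N); split.
- have mf : measurable_fun (setT : set (measurableTypeR R))
    (fun r => x 0 0 + s * r : measurableTypeR R) by exact: affine_measurable.
  by rewrite -[X in measurable X]setTI; exact: mf.
- exact: lebesgue_null_affine.
move=> a /= ha; apply: hN => /= hm; apply: ha => _.
rewrite (_ : _ @^-1` _ = tuple_affine (\row_i x 0 (lift ord0 i)) s @^-1`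
    ((fun t : n.-tuple R => [tuple of (x 0 0 + s * a) :: t]) @^-1` A)); last first.
  by apply/seteqP; split => t /=; rewrite tuple_affine_cons.
apply: IHn; last exact: hm.
rewrite -[X in measurable X]setTI.
exact: (measurableT_comp (@measurable_tuple_cons R n) (pair1_measurable (x 0 0 + s * a : measurableTypeR R))).
Qed.

Lemma tuple_measure_box_gt0 n (e : R) : 0 < e ->
  (0 < tuple_measure n [set t | forall i, (`|tnth t i| < e)%R])%E.
Proof.
move=> e0; elim: n => [|n IHn].
  by rewrite /= diracE mem_set ?lte_fin//= => -[].
rewrite tuple_measureS.
have E a : (fun t : n.-tuple R => [tuple of a :: t]) @^-1` [set t | forall i, `|tnth t i| < e] =
    if `|a| < e then [set t | forall i, `|tnth t i| < e] else set0.
  case: ifPn => ae; apply/seteqP; split => t //=.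
  - by move=> h i; have := h (lift ord0 i); rewrite tnthS.
  - move=> h i; case: (unliftP ord0 i) => [j ->|->]; first by rewrite tnthS.
    by rewrite tnth0.
  - by move=> /(_ ord0); rewrite tnth0 (negbTE ae).
under eq_integral do rewrite E.
pose c := tuple_measure n [set t | forall i, (`|tnth t i| < e)%R].
apply: (@lt_le_trans _ _ (\int[leb]_(a in `](- e)%R, e[) c)%E).
  rewrite integral_cst//= lebesgue_measure_itv/= lte_fin gtrN// -EFinB.
  by rewrite mule_gt0// lte_fin; lra.
rewrite [leLHS]integral_mkcond le_eqVlt; apply/orP; left; apply/eqP.
apply: eq_integral => a _; rewrite patchE.
have -> : (a \in (`]- e, e[%classic : set (measurableTypeR R))) = (`|a| < e).
  by apply/idP/idP; rewrite inE/= in_itv/= -ltr_norml.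
by case: ifPn => _ //; rewrite measure0.
Qed.

End NullSets.

(** * Gaussians on tuples and their concentration *)

Section GaussianTuple.
Context {R : realType}.
Notation leb := (@lebesgue_measure R).

Definition sqnorm n (t : n.-tuple R) : R := \sum_(i < n) tnth t i ^+ 2.

Lemma measurable_sqnorm n : measurable_fun setT (@sqnorm n).
Proof.
apply: measurable_sum => i; apply: measurable_funX; exact: measurable_tnth.
Qed.

Lemma integrable_gauss_tuple n (a : R) : 0 < a ->
  (tuple_measure n).-integrable setT (EFin \o (fun t => expR (- (a * sqnorm t)))).
Proof.
move=> a0.
have m k : measurable_fun setT (fun t : k.-tuple R => expR (- (a * sqnorm t))).
  apply: measurableT_comp => //; apply: measurableT_comp => //.
  by apply: measurable_funM => //; exact: measurable_sqnorm.
apply/integrableP; split; first by apply/measurable_EFinP; exact: m.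
under eq_integral do rewrite /= ger0_norm ?expR_ge0//.
elim: n => [|n IHn].
  rewrite integral_dirac//=; first by rewrite diracT mul1e ltry.
  by apply/measurable_EFinP; exact: m.
rewrite ge0_integral_tuple_cons; last 2 first.
- by apply/measurable_EFinP; exact: m.
- by move=> t; rewrite lee_fin expR_ge0.
set c := (X in (X < _)%E) in IHn.
have E b : (\int[tuple_measure n]_t (expR (- (a * sqnorm [tuple of b :: t])))%:E =
    (expR (- (a * b ^+ 2)))%:E * c)%E.
  rewrite -ge0_integralZl ?lee_fin ?expR_ge0//; last by apply/measurable_EFinP; exact: m.
  apply: eq_integral => t _; rewrite -EFinM -expRD; congr (EFin (expR _)).
  rewrite /sqnorm big_ord_recl tnth0 mulrDr opprD; congr (_ - _ * _).
  by apply: eq_bigr => i _; rewrite tnthS.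
under eq_integral do rewrite E.
have c0 : (0 <= c)%E by apply: integral_ge0 => t _; rewrite lee_fin expR_ge0.
have cfin : c \is a fin_num by rewrite ge0_fin_numE.
rewrite -(fineK cfin); under eq_integral do rewrite muleC.
have := integrableZ_real (fine c) (integrable_gauss0 a0).
move=> /integrableP[_]; apply: le_lt_trans.
rewrite le_eqVlt; apply/orP; left; apply/eqP; apply: eq_integral => s _ /=.
by rewrite -EFinM ger0_norm// mulr_ge0 ?expR_ge0 ?fine_ge0.
Qed.

End GaussianTuple.

Section Concentration.
Context d (T : measurableType d) (R : realType) (mu : {measure set T -> \bar R}).

(** For q < de/2 the integrand is at least c exp(-y de/2), for de/2 <= q < de it is nonnegative, and
    beyond it is at least -|g| exp(-y de). With m the measure of the first region and K the integral
    of |g|, vanishing would force c m exp(y de/2) <= K for all y > 0. *)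
Lemma gauss_concentration (g q : T -> R) (c de : R) : 0 < c -> 0 < de ->
  mu.-integrable setT (EFin \o g) -> measurable_fun setT q -> (forall t, 0 <= q t) ->
  (forall t, q t < de -> c <= g t) -> (0 < mu [set t | (q t < de / 2)%R])%E ->
  (forall y, 0 < y -> \int[mu]_t (g t * expR (- (y * q t))) = 0) -> False.
Proof.
move=> c0 de0 ig mq q0 gc mpos h.
have mg := measurable_integrable ig.
pose B := [set t | q t < de / 2].
have mB : measurable B.
  rewrite (_ : B = setT `&` q @^-1` `]-oo, (de / 2)[%classic); first exact: mq.
  by rewrite setTI; apply/seteqP; split => t; rewrite /= in_itv.
(* The region has finite measure because g >= c on it. *)
have iB : mu.-integrable setT (EFin \o (\1_B : T -> R)).
  apply: (@le_integrable_real _ _ _ _ _ (fun t => c^-1 * `|g t|)).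
  - exact: measurable_indic.
  - move=> t; rewrite indicE; case: (boolP (t \in B)) => [|_]; last first.
      by rewrite normr0 mulr_ge0 ?invr_ge0 ?(ltW c0).
    rewrite inE normr1 => Bt.
    have /gc : q t < de by apply: lt_le_trans Bt _; lra.
    by rewrite mulrC ler_pdivlMr// mul1r => /le_trans; apply; exact: ler_norm.
  - by apply: integrableZ_real; exact: integrable_norm.
pose m := \int[mu]_t (\1_B t : R).
have m0 : 0 < m.
  rewrite /m /Rintegral integral_indic// setIT fine_gt0// mpos/=.
  have /integrableP[_] := iB.
  under eq_integral do rewrite /= ger0_norm//.
  by rewrite integral_indic// setIT.
pose K := \int[mu]_t `|g t|.
have K0 : 0 <= K by apply: Rintegral_ge0.
have key y : 0 < y -> c * m * expR (y * (de / 2)) <= K.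
  move=> y0; have e0 := h _ y0.
  have iN := integrable_norm ig.
  have i1 := integrableZ_real (c * expR (- (y * (de / 2)))) iB.
  have i2 := integrableZ_real (expR (- (y * de))) iN.
  have : \int[mu]_t (c * expR (- (y * (de / 2))) * \1_B t - expR (- (y * de)) * `|g t|) <=
      \int[mu]_t (g t * expR (- (y * q t))).
    apply: le_Rintegral => //.
    - exact: (integrableB measurableT i1 i2).
    - apply: le_integrable_real iN.
        apply: measurable_funM => //; apply: measurableT_comp => //.
        by apply: measurableT_comp => //; exact: measurable_funM.
      move=> t; rewrite normrM ler_piMr// gtr0_norm ?expR_gt0// -[leRHS]expR0 ler_expR.
      by rewrite oppr_le0 mulr_ge0// ltW.
    move=> t _; rewrite indicE; have [qde|qde] := ltP (q t) de; last first.
      rewrite memNset; last by move=> /= qq; move: qde; rewrite leNgt (lt_le_trans qq)//; lra.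
      rewrite mulr0 sub0r mulrC -mulrN -[leRHS]opprK.
      apply: (@le_trans _ _ (- `|g t| * expR (- (y * q t)))).
        rewrite mulrN mulNr lerN2 ler_wpM2l// ler_expR lerN2 ler_wpM2l// ltW//.
      by rewrite opprK ler_wpM2r ?expR_ge0// lerNl ler_normr lexx orbT.
    have cg := gc _ qde.
    apply: (@le_trans _ _ (g t * expR (- (y * q t)) - expR (- (y * de)) * `|g t|)); last first.
      by rewrite gerBl mulr_ge0 ?expR_ge0.
    rewrite lerD2r; case: (boolP (t \in B)) => [|_]; last first.
      by rewrite mulr0 mulr_ge0 ?expR_ge0// (le_trans _ cg)// ltW.
    rewrite inE mulr1 => Bt; apply: ler_pM => //; rewrite ?expR_ge0 ?(ltW c0)//.
    by rewrite ler_expR lerN2 ler_wpM2l ?(ltW y0)// ltW.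
  rewrite e0 RintegralB// !RintegralZl// subr_le0 -/m -/K => hh.
  have := ler_wpM2l (expR_ge0 (y * de)) hh.
  have -> : expR (y * de) * (expR (- (y * de)) * K) = K.
    by rewrite mulrA -expRD subrr expR0 mul1r.
  move=> /(le_trans _); apply.
  have -> : expR (y * (de / 2)) = expR (y * de) * expR (- (y * (de / 2))).
    by rewrite -expRD; congr expR; field.
  by rewrite le_eqVlt; apply/orP; left; apply/eqP; ring.
have cm : 0 < c * m by rewrite mulr_gt0.
(* Makes y de/2 equal to (K + 1) / (c m), whose exponential exceeds K / (c m). *)
pose y := (K + 1) / (c * m) / (de / 2).
have y0 : 0 < y by rewrite /y !divr_gt0// ltr_wpDl.
have := key _ y0; apply/negP; rewrite -ltNge.
rewrite mulrC -ltr_pdivrMr//.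
have -> : y * (de / 2) = (K + 1) / (c * m) by rewrite /y divfK// lt0r_neq0 ?divr_gt0.
apply: (@lt_trans _ _ ((K + 1) / (c * m))).
  by rewrite ltr_pM2r ?invr_gt0// ltrDl.
apply: lt_le_trans (expR_ge1Dx _); by rewrite ltrDr.
Qed.

End Concentration.

(** * Invertibility of the matrix exponential *)

Section MatrixExponential.
Context {R : realType}.

Lemma sum_triangle (V : zmodType) (F : nat -> nat -> V) n :
  \sum_(0 <= i < n) \sum_(0 <= j < n - i) F i j =
  \sum_(0 <= k < n) \sum_(0 <= i < k.+1) F i (k - i)%N.
Proof.
elim: n => [|n IHn]; first by rewrite !big_geq.
rewrite [RHS]big_nat_recr//= -IHn [LHS]big_nat_recr//= subSnn big_nat1.
rewrite [X in _ = _ + X]big_nat_recr//= subnn addrA; congr (_ + _).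
rewrite -big_split/=; apply: eq_big_nat => i /andP[_ ilt].
by rewrite subSn ?(ltnW ilt)// big_nat_recr.
Qed.

(** At x = -1 the right-hand side vanishes for n > 0, the cancellation behind exp(A) exp(-A) = 1; at
    x = 1 it yields the coefficients of exp(2a). *)
Lemma binomial_fact_sum (x : R) n :
  \sum_(0 <= i < n.+1) ((i`!%:R)^-1 * ((n - i)`!%:R)^-1 * x ^+ (n - i)) =
  (n`!%:R)^-1 * (1 + x) ^+ n.
Proof.
rewrite addrC exprDn mulr_sumr big_mkord; apply: eq_bigr => i _.
have ilen : (i <= n)%N by rewrite -ltnS.
rewrite expr1n mulr1 -[_ *+ 'C(n, i)]mulr_natr.
have nz k : (k`!%:R : R) != 0 by rewrite pnatr_eq0 -lt0n fact_gt0.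
have -> : (n`!%:R : R) = 'C(n, i)%:R * (i`!%:R * (n - i)`!%:R).
  by rewrite -!natrM bin_fact.
by field; rewrite !nz pnatr_eq0 -lt0n bin_gt0 ilen.
Qed.

Variable m : nat.
Implicit Type A : 'M[R]_m.

Definition entry_sum A : R := \sum_i \sum_j `|A i j|.

Lemma entry_sum_ge0 A : 0 <= entry_sum A.
Proof. by apply: sumr_ge0 => i _; apply: sumr_ge0. Qed.

Lemma entry_pow_le A k i j : `|(A ^+ k) i j| <= entry_sum A ^+ k.
Proof.
elim: k i j => [|k IHk] i j.
  by rewrite !expr0 mxE; case: eqP => _; rewrite ?normr1 ?normr0.
rewrite exprS mxE exprS.
apply: le_trans (ler_norm_sum _ _ _) _.
apply: (@le_trans _ _ ((\sum_l `|A i l|) * entry_sum A ^+ k)).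
  by rewrite mulr_suml; apply: ler_sum => l _; rewrite normrM ler_wpM2l.
rewrite ler_wpM2r ?exprn_ge0 ?entry_sum_ge0// /entry_sum [X in _ <= X](bigD1 i)//= lerDl.
by apply: sumr_ge0 => l _; apply: sumr_ge0.
Qed.

Definition expmx_sum A N : 'M[R]_m := \sum_(k < N) (k`!%:R)^-1 *: A ^+ k.

Lemma expmx_sumE A N i j : expmx_sum A N i j = \sum_(0 <= k < N) (k`!%:R)^-1 * (A ^+ k) i j.
Proof. by rewrite summxE big_mkord; apply: eq_bigr => k _; rewrite mxE. Qed.

Lemma mx_norm_le_entry A (c : R) : 0 <= c -> (forall i j, `|A i j| <= c) -> `|A| <= c.
Proof.
move=> c0 h; rewrite [leLHS]mx_normrE; apply: bigmax_le => // -[i j] _; exact: h.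
Qed.

Lemma cvg_expmx_sum A : expmx_sum A N @[N --> \oo] --> expmx A.
Proof.
have cv i j : cvgn (fun N => expmx_sum A N i j).
  suff : cvgn (series (fun k => (k`!%:R)^-1 * (A ^+ k) i j)).
    by rewrite /series/=; under eq_fun do rewrite -expmx_sumE.
  apply: normed_cvg; apply: (series_le_cvg _ _ _ (is_cvg_series_exp_coeff (entry_sum A))).
  - by move=> k /=.
  - by move=> k; apply: exp_coeff_ge0; exact: entry_sum_ge0.
  - move=> k /=; rewrite normrM ger0_norm ?invr_ge0// mulrC ler_wpM2r ?invr_ge0//.
    exact: entry_pow_le.
suff h : expmx_sum A N @[N --> \oo] --> (\matrix_(i, j) limn (fun N => expmx_sum A N i j) : 'M[R]_m).
  exact: (cvgP _ h).
apply/cvgrPdist_le => e e0.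
have h i j : \forall N \near \oo,
    `|limn (fun N => expmx_sum A N i j) - expmx_sum A N i j| <= e.
  by have /cvgrPdist_le/(_ e e0) := cv i j.
have : \forall N \near \oo, forall i j,
    `|limn (fun N => expmx_sum A N i j) - expmx_sum A N i j| <= e.
  by apply: filter_forall => i; apply: filter_forall => j.
apply: filterS => N hN; apply: mx_norm_le_entry => [|i j]; first exact: ltW.
by rewrite !mxE; exact: hN.
Qed.

Lemma cvg_expmx_sum_entry A i j : expmx_sum A N i j @[N --> \oo] --> expmx A i j.
Proof.
exact: (cvg_comp _ _ (@cvg_expmx_sum A) (@coord_continuous R m m i j (expmx A))).
Qed.

Lemma mx_exprN A q : (- A) ^+ q = (-1) ^+ q *: A ^+ q.
Proof.
elim: q => [|q IHq]; first by rewrite !expr0 scale1r.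
rewrite !exprS IHq -[- A * _]/(- A *m _) -[A * _]/(A *m _).
by rewrite -scalemxAr mulNmx mulN1r scaleNr scalerN.
Qed.

(* The Cauchy product of the two truncated series is the identity up to the terms
   of degree >= N, which are bounded by those of exp(a)^2 - exp(2a). *)
Lemma expmx_sum_mul_le A N i j : (0 < N)%N ->
  `|(expmx_sum A N *m expmx_sum (- A) N) i j - (1%:M : 'M[R]_m) i j| <=
  (\sum_(k < N) (k`!%:R)^-1 * entry_sum A ^+ k) ^+ 2 -
  \sum_(k < N) (k`!%:R)^-1 * (2 * entry_sum A) ^+ k.
Proof.
move=> N0; set a := entry_sum A.
pose F (p q : nat) : R := (p`!%:R)^-1 * (q`!%:R)^-1 * (-1) ^+ q * (A ^+ (p + q)) i j.
pose G (p q : nat) : R := (p`!%:R)^-1 * (q`!%:R)^-1 * a ^+ (p + q).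
have FG p q : `|F p q| <= G p q.
  rewrite /F /G !normrM normrX normrN1 expr1n mulr1 [ `|(p`!%:R)^-1|]ger0_norm ?invr_ge0//.
  rewrite [ `|(q`!%:R)^-1|]ger0_norm ?invr_ge0//.
  by rewrite ler_wpM2l ?mulr_ge0 ?invr_ge0// entry_pow_le.
(* The square of index pairs is cut into the diagonals of degree below [N] and the remaining corner,
   where F is bounded termwise by G. *)
have split (H : nat -> nat -> R) : \sum_(0 <= p < N) \sum_(0 <= q < N) H p q =
    \sum_(0 <= k < N) \sum_(0 <= p < k.+1) H p (k - p)%N +
    \sum_(0 <= p < N) \sum_(N - p <= q < N) H p q.
  rewrite -sum_triangle -big_split/=; apply: eq_big_nat => p _.
  by rewrite (@big_cat_nat _ _ _ (N - p)%N)// leq_subr.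
have EF : (expmx_sum A N *m expmx_sum (- A) N) i j =
    \sum_(0 <= p < N) \sum_(0 <= q < N) F p q.
  rewrite /expmx_sum mulmx_suml summxE big_mkord; apply: eq_bigr => p _.
  rewrite mulmx_sumr summxE big_mkord; apply: eq_bigr => q _.
  rewrite mx_exprN -scalemxAl -!scalemxAr -[A ^+ p *m A ^+ q]/(A ^+ p * A ^+ q) -exprD.
  by rewrite mxE mxE mxE /F -!mulrA.
have EG : \sum_(0 <= p < N) \sum_(0 <= q < N) G p q = (\sum_(k < N) (k`!%:R)^-1 * a ^+ k) ^+ 2.
  rewrite expr2 mulr_suml big_mkord; apply: eq_bigr => p _.
  rewrite mulr_sumr big_mkord; apply: eq_bigr => q _.
  by rewrite /G exprD; ring.
have TF : \sum_(0 <= k < N) \sum_(0 <= p < k.+1) F p (k - p)%N = (1%:M : 'M[R]_m) i j.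
  have e k : \sum_(0 <= p < k.+1) F p (k - p)%N =
      (k`!%:R)^-1 * (1 + - 1) ^+ k * (A ^+ k) i j.
    rewrite -binomial_fact_sum mulr_suml; apply: eq_big_nat => p /andP[_ pk].
    by rewrite /F subnKC.
  under eq_bigr do rewrite e subrr.
  rewrite big_ltn// big1_seq ?addr0; first by rewrite expr0 fact0 invr1 !mul1r expr0.
  move=> k /andP[_]; rewrite mem_index_iota => /andP[k0 _].
  by rewrite expr0n eqn0Ngt k0 mulr0 mul0r.
have TG : \sum_(0 <= k < N) \sum_(0 <= p < k.+1) G p (k - p)%N =
    \sum_(k < N) (k`!%:R)^-1 * (2 * a) ^+ k.
  rewrite big_mkord; apply: eq_bigr => k _.
  rewrite exprMn mulrA -[2]/(1 + 1) -binomial_fact_sum mulr_suml; apply: eq_big_nat => p /andP[_ pk].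
  by rewrite /G subnKC// expr1n mulr1.
rewrite EF -EG split TF addrC addKr (split G) TG addrC addKr.
apply: le_trans (ler_norm_sum _ _ _) _; apply: ler_sum => p _.
by apply: le_trans (ler_norm_sum _ _ _) _; apply: ler_sum => q _.
Qed.

(** The error bound tends to exp(a)^2 - exp(2a) = 0. The resulting invertibility of the flow matrix
    S lets the Wigner identity be read at S z, where it returns the value at z. *)
Lemma expmx_mulN A : expmx A *m expmx (- A) = 1%:M.
Proof.
apply/matrixP => i j.
pose P N := (expmx_sum A N *m expmx_sum (- A) N) i j.
have c1 : P N @[N --> \oo] --> (expmx A *m expmx (- A)) i j.
  rewrite mxE /P; under eq_fun do rewrite mxE.
  apply: cvg_big => [|l _]; first exact: add_continuous.
  by apply: cvgM; exact: cvg_expmx_sum_entry.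
apply: (cvg_unique _ c1) => //.
apply/cvgrPdist_le => /= e e0.
pose a := entry_sum A.
have c2 : (\sum_(k < N) (k`!%:R)^-1 * a ^+ k) ^+ 2 -
    \sum_(k < N) (k`!%:R)^-1 * (2 * a) ^+ k @[N --> \oo] --> (0 : R).
  rewrite -[X in _ --> X](subrr (expR (2 * a))).
  apply: cvgB; last exact: expR_series.
  rewrite expRM_natl.
  by apply: cvgM; exact: expR_series.
have /cvgrPdist_le/(_ e e0) := c2; apply: filterS2 (nbhs_infty_gt 0) => N N0 /=.
rewrite sub0r normrN => h.
rewrite distrC; apply: le_trans (expmx_sum_mul_le A i j N0) _.
exact: le_trans (ler_norm _) h.
Qed.

Lemma expmx_unit A : expmx A \in unitmx.
Proof. by have /mulmx1_unit[] := expmx_mulN A. Qed.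

End MatrixExponential.

(** * Measurability of continuous functions of several variables *)

Section ContinuousMeasurable.
Context {R : realType}.

Definition discretize (k : nat) (r : R) : R := (Num.floor (k.+1%:R * r))%:~R / k.+1%:R.

Lemma cvg_discretize r : discretize k r @[k --> \oo] --> r.
Proof.
apply/cvgrPdist_le => /= e e0.
near=> k.
have k0 : 0 < k.+1%:R :> R by [].
have := floor_itv (k.+1%:R * r) => /andP[h1 h2].
rewrite ger0_norm; last by rewrite subr_ge0 /discretize ler_pdivrMr// [r * _]mulrC.
rewrite lerBlDr -lerBlDl /discretize ler_pdivlMr//.
have : k.+1%:R * e >= 1.
  have kk : 1 / e < k%:R by near: k; exact: nbhs_infty_gtr.
  by rewrite -ler_pdivrMr// ltW// (lt_le_trans kk)// ler_nat.
move: h2; rewrite intrD; lra.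
Unshelve. all: by end_near. Qed.

(** Continuity refers to row matrices, measurability to the product sigma-algebra of tuples.
    Rounding coordinates down to multiples of 1/(k+1) gives a map with countably many values, taken
    on boxes, and F is the pointwise limit of its compositions with these maps. *)
Lemma measurable_continuous_row n (F : 'rV[R]_n -> R) : continuous F ->
  measurable_fun setT (F \o @row_of_tuple R n).
Proof.
move=> cF.
pose D k (t : n.-tuple R) : 'rV[R]_n := \row_i discretize k (tnth t i).
apply: (@measurable_fun_cvg _ _ _ _ (fun k => F \o D k)) => [k|t _]; last first.
  apply: (cvg_comp (fun k => D k t) F); last exact: cF.
  apply/cvgrPdist_le => e e0.
  have h (i : 'I_n) : \forall k \near \oo, `|tnth t i - discretize k (tnth t i)| <= e.
    by have /cvgrPdist_le/(_ e e0) := @cvg_discretize (tnth t i).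
  have : \forall k \near \oo, forall i : 'I_n, `|tnth t i - discretize k (tnth t i)| <= e.
    exact: filter_forall.
  apply: filterS => k hk; rewrite [leLHS]mx_normrE; apply: bigmax_le; first exact: ltW.
  by move=> [i0 i] _; rewrite !mxE /=; exact: hk.
move=> _ B mB; rewrite setTI.
pose C (q : n.-tuple int) : set (n.-tuple R) :=
  \big[setI/setT]_(i < n) ((@tnth n R ^~ i) @^-1` [set r | Num.floor (k.+1%:R * r) = tnth q i]).
pose V (q : n.-tuple int) : 'rV[R]_n := \row_i ((tnth q i)%:~R / k.+1%:R).
have mC q : measurable (C q).
  apply: bigsetI_measurable => i _; rewrite -[X in measurable X]setTI.
  apply: measurable_tnth => //.
  rewrite (_ : [set _ | _] =
    `[(tnth q i)%:~R / k.+1%:R, (tnth q i + 1)%:~R / k.+1%:R[%classic)//.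
  have k0 : 0 < k.+1%:R :> R by [].
  apply/seteqP; split => r /=; rewrite in_itv/= ler_pdivrMr// ltr_pdivlMr// mulrC.
    by move=> <-; exact: floor_itv.
  exact: floor_def.
have inC q t : C q t <-> forall i, Num.floor (k.+1%:R * tnth t i) = tnth q i.
  by rewrite /C -bigcap_seq/=; split => [h i|h i _ /=]; [apply: h; rewrite /= mem_index_enum|].
rewrite (_ : _ @^-1` B = \bigcup_(q in [set q | B (F (V q))]) C q).
  by rewrite bigcup_mkcond; apply: countable_bigcupT_measurable => // q; case: ifP.
apply/seteqP; split => [t /= Bt|t [q /= Bq /inC hq]].
  exists [tuple Num.floor (k.+1%:R * tnth t i) | i < n]; last first.
    by apply/inC => i; rewrite tnth_mktuple.
  rewrite /= (_ : V _ = D k t)//; apply/rowP => i; rewrite !mxE tnth_mktuple//.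
rewrite /= (_ : D k t = V q)//; apply/rowP => i; rewrite !mxE /discretize hq//.
Qed.

End ContinuousMeasurable.

(** * Positive-definite forms *)

Section PositiveDefinite.
Context {R : realType} (n : nat) (M : 'M[R]_n).
Hypothesis pM : posdef M.

Definition bform (M : 'M[R]_n) (x y : 'rV[R]_n) : R := (x *m M *m y^T) 0 0.

Lemma qformE x : qform M x = bform M x x.
Proof. by rewrite /qform /dotv /bform pM.1. Qed.

Lemma bformDl x y z : bform M (x + y) z = bform M x z + bform M y z.
Proof. by rewrite /bform !mulmxDl mxE. Qed.

Lemma bformZl a x z : bform M (a *: x) z = a * bform M x z.
Proof. by rewrite /bform -!scalemxAl mxE. Qed.

Lemma bformC x y : bform M x y = bform M y x.
Proof.
rewrite /bform -[LHS]/((fun A : 'M[R]_1 => A 0 0) (x *m M *m y^T)).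
by rewrite -(trmxK (x *m M *m y^T)) mxE !trmx_mul trmxK pM.1 mulmxA.
Qed.

Lemma bformDr x y z : bform M z (x + y) = bform M z x + bform M z y.
Proof. by rewrite !(bformC z) bformDl. Qed.

Lemma bformZr a x z : bform M z (a *: x) = a * bform M z x.
Proof. by rewrite !(bformC z) bformZl. Qed.

Lemma qform_ge0 x : 0 <= qform M x.
Proof.
have [->|x0] := eqVneq x 0; last by rewrite ltW//; exact: pM.2.
by rewrite qformE /bform !mul0mx mxE.
Qed.

Lemma qformD x y : qform M (x + y) = qform M x + 2 * bform M x y + qform M y.
Proof. by rewrite !qformE bformDl !bformDr (bformC y x); ring. Qed.

Lemma qformZ a x : qform M (a *: x) = a ^+ 2 * qform M x.
Proof. by rewrite !qformE bformZl bformZr; ring. Qed.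

(** The Gaussian exponents at x + t/2 and x - t/2 add up to a term in x alone and a term in t
    alone. *)
Lemma qform_parallelogram x t :
  qform M (x + 2^-1 *: t) + qform M (x - 2^-1 *: t) = 2 * qform M x + 2^-1 * qform M t.
Proof. by rewrite -scaleNr !qformD !qformZ !bformZr; field. Qed.

Lemma bform_cauchy_schwarz x y : bform M x y ^+ 2 <= qform M x * qform M y.
Proof.
have [->|y0] := eqVneq y 0.
  by rewrite (_ : bform M x 0 = 0) ?expr0n ?mulr_ge0 ?qform_ge0// /bform trmx0 mulmx0 mxE.
have q0 := pM.2 y y0.
have := qform_ge0 (x + (- (bform M x y / qform M y)) *: y).
rewrite qformD qformZ bformZr => h.
have {}h : 0 <= (qform M x - bform M x y ^+ 2 / qform M y) * qform M y.
  rewrite mulr_ge0 ?qform_ge0//; move: h; congr (0 <= _).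
  by field; exact: lt0r_neq0.
by move: h; rewrite mulrBl divfK ?lt0r_neq0// subr_ge0.
Qed.

Lemma posdef_unitmx : M \in unitmx.
Proof.
rewrite -row_free_unit -kermx_eq0; apply/rowV0P => v /sub_kermxP vM.
apply/eqP; apply: contraT => v0; have := pM.2 v v0.
by rewrite qformE /bform vM mul0mx mxE ltxx.
Qed.

(** Each coordinate is x_i = [bform M (e i) x] with [e i] the i-th row of M^-1, so Cauchy-Schwarz
    for M bounds x_i^2. The added 1 keeps the constant positive in dimension 0. *)
Lemma posdef_coercive : exists2 kap : R, 0 < kap &
  forall x : 'rV[R]_n, \sum_i x 0 i ^+ 2 <= kap * qform M x.
Proof.
pose e i : 'rV[R]_n := delta_mx 0 i *m invmx M.
exists (1 + \sum_i qform M (e i)).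
  by rewrite ltr_wpDr// sumr_ge0// => i _; exact: qform_ge0.
move=> x; rewrite mulrDl mul1r ler_wpDl ?qform_ge0// mulr_suml; apply: ler_sum => i _.
have -> : x 0 i = bform M (e i) x.
  by rewrite /bform /e mulmxKV ?posdef_unitmx// -rowE !mxE.
by apply: le_trans (bform_cauchy_schwarz _ _) _; rewrite lexx.
Qed.

End PositiveDefinite.

(** * Uniqueness for the cosine transform *)

Section CosineUniqueness.
Context {R : realType}.
Notation leb := (@lebesgue_measure R).

Lemma dotvE n (x y : 'rV[R]_n) : dotv x y = \sum_i x 0 i * y 0 i.
Proof. by rewrite /dotv mxE; apply: eq_bigr => i _; rewrite mxE. Qed.

Lemma dotvDl n (x y z : 'rV[R]_n) : dotv (x + y) z = dotv x z + dotv y z.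
Proof. by rewrite /dotv mulmxDl mxE. Qed.

Lemma dotvZl n a (x z : 'rV[R]_n) : dotv (a *: x) z = a * dotv x z.
Proof. by rewrite /dotv -scalemxAl mxE. Qed.

Lemma dotv_delta n i (x : 'rV[R]_n) : dotv (delta_mx 0 i) x = x 0 i.
Proof. by rewrite /dotv -rowE !mxE. Qed.

Lemma measurable_dotv_row n (x : 'rV[R]_n) :
  measurable_fun setT (fun t : n.-tuple R => dotv x (row_of_tuple t)).
Proof.
under eq_fun do rewrite dotvE.
apply: measurable_sum => i; apply: measurable_funM => //.
by under eq_fun do rewrite mxE; exact: measurable_tnth.
Qed.

Lemma cosDB (a b : R) : cos (a + b) + cos (a - b) = 2 * (cos a * cos b).
Proof. by rewrite cosD cosB; ring. Qed.

(* Integrating the hypothesis against Gaussians in one frequency at a time puts a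
   Gaussian weight in every coordinate, which then concentrates at 0. *)
Lemma cos_transform_eq0_le0 n (G : 'rV[R]_n -> R) :
  (tuple_measure n).-integrable setT (EFin \o (fun t => G (row_of_tuple t))) ->
  {for 0, continuous G} ->
  (forall xi, \int[tuple_measure n]_t
     (G (row_of_tuple t) * cos (2 * pi * dotv xi (row_of_tuple t))) = 0) ->
  G 0 <= 0.
Proof.
move=> iG cG hG.
have mC : measurable_fun setT (@cos R).
  by apply: continuous_measurable_fun; exact: continuous_cos.
(* [s] lists the coordinates that already carry a Gaussian weight; it ends as the whole index
   set. *)
pose q (s : seq 'I_n) (t : n.-tuple R) : R := \sum_(i <- s) tnth t i ^+ 2.
have mq s : measurable_fun setT (q s).
  by apply: measurable_sum => i; apply: measurable_funX; exact: measurable_tnth.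
have q0 s t : 0 <= q s t by apply: sumr_ge0 => i _; exact: sqr_ge0.
have mcos xi : measurable_fun setT (fun t : n.-tuple R => cos (2 * pi * dotv xi (row_of_tuple t))).
  by apply: (measurableT_comp mC); apply: measurable_funM => //; exact: measurable_dotv_row.
have igauss y s xi : 0 < y -> (tuple_measure n).-integrable setT (EFin \o (fun t =>
    G (row_of_tuple t) * expR (- (y * q s t)) * cos (2 * pi * dotv xi (row_of_tuple t)))).
  move=> y0; apply: le_integrable_real (integrable_norm iG).
    apply: measurable_funM => //; apply: measurable_funM.
      exact: measurable_integrable iG.
    apply: measurableT_comp => //; apply: measurableT_comp => //.
    exact: measurable_funM.
  move=> t; apply: le_trans (ler_norm_mul_cos _ _) _.
  rewrite normrM ler_piMr// gtr0_norm ?expR_gt0// -[leRHS]expR0 ler_expR.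
  by rewrite oppr_le0 mulr_ge0// ltW.
have key y s xi : 0 < y -> \int[tuple_measure n]_t
    (G (row_of_tuple t) * expR (- (y * q s t)) * cos (2 * pi * dotv xi (row_of_tuple t))) = 0.
  move=> y0; elim: s xi => [|j s IHs] xi.
    rewrite -[RHS](hG xi); apply: eq_Rintegral => t _.
    by rewrite /q big_nil mulr0 oppr0 expR0 mulr1.
  pose k (t : n.-tuple R) := G (row_of_tuple t) * expR (- (y * q s t)) *
    cos (2 * pi * dotv xi (row_of_tuple t)).
  have ik : (tuple_measure n).-integrable setT (EFin \o k) by exact: igauss.
  have mk := measurable_integrable ik.
  have yp : 0 < y / pi by rewrite divr_gt0// pi_gt0.
  have := cos_transform_gauss mk (@measurable_tnth _ R n j) ik yp.
  have -> : \int[leb]_s0 (cos_transform (tuple_measure n) k ((tnth (T:=R))^~ j) s0 *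
      expR (- (pi * s0 ^+ 2 / (y / pi)))) = 0.
    rewrite -[RHS](mul0r (fine (leb setT))) -(Rintegral_cst leb measurableT 0).
    apply: eq_Rintegral => s0 _.
    suff -> : cos_transform (tuple_measure n) k ((tnth (T:=R))^~ j) s0 = 0 by rewrite mul0r.
    (* Twice the product of the two cosines is the sum of the cosines at the frequencies xi + s0 e_j
       and xi - s0 e_j, where the induction hypothesis gives zero. *)
    have h1 := IHs (xi + s0 *: delta_mx 0 j); have h2 := IHs (xi - s0 *: delta_mx 0 j).
    have i1 := igauss y s (xi + s0 *: delta_mx 0 j) y0.
    have i2 := igauss y s (xi - s0 *: delta_mx 0 j) y0.
    have := RintegralD measurableT i1 i2; rewrite h1 h2 addr0 => h3.
    have : 2 * cos_transform (tuple_measure n) k ((tnth (T:=R))^~ j) s0 = 0.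
      rewrite /cos_transform -RintegralZl//; last first.
        apply: le_integrable_real (integrable_norm ik).
          apply: measurable_funM => //; apply: (measurableT_comp mC).
          by apply: measurable_funM => //; exact: measurable_tnth.
        by move=> t; exact: ler_norm_mul_cos.
      rewrite -h3; apply: eq_Rintegral => t _.
      have dp : dotv (xi + s0 *: delta_mx 0 j) (row_of_tuple t) =
          dotv xi (row_of_tuple t) + s0 * tnth t j.
        by rewrite dotvDl dotvZl dotv_delta mxE.
      have dm : dotv (xi - s0 *: delta_mx 0 j) (row_of_tuple t) =
          dotv xi (row_of_tuple t) - s0 * tnth t j.
        by rewrite -scaleNr dotvDl dotvZl dotv_delta mxE mulNr.
      rewrite dp dm -mulrDr (mulrDr (2 * pi)) (mulrBr (2 * pi)) cosDB [2 * pi * (s0 * _)]mulrA /k; ring.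
    by move/eqP; rewrite mulf_eq0 pnatr_eq0/= => /eqP.
  move=> /esym/eqP; rewrite mulf_eq0 gt_eqF ?sqrtr_gt0//= => /eqP h.
  rewrite -[RHS]h; apply: eq_Rintegral => t _; rewrite /k /q big_cons.
  rewrite mulrDr opprD expRD.
  have -> : y / pi * (pi * tnth t j ^+ 2) = y * tnth t j ^+ 2.
    by rewrite mulrA divfK// lt0r_neq0// pi_gt0.
  by ring.
rewrite leNgt; apply/negP => G0.
have [de de0 hde] : exists2 de, 0 < de & forall x, `|x| < de -> G 0 / 2 <= G x.
  have g2 : 0 < G 0 / 2 by rewrite divr_gt0.
  have /cvgrPdist_le/(_ _ g2)/nbhs_ballP[de de0 h] := cG.
  exists de => // x xde; have : `|G 0 - G x| <= G 0 / 2.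
    by apply: h; rewrite -ball_normE /= sub0r normrN.
  by rewrite ler_norml; lra.
have de2 : 0 < de ^+ 2 by rewrite exprn_gt0.
apply: (@gauss_concentration _ _ R (tuple_measure n) (fun t => G (row_of_tuple t))
  (q (index_enum 'I_n)) (G 0 / 2) (de ^+ 2)) => //.
- by rewrite divr_gt0.
- move=> t qt; apply: hde; rewrite [X in X < _]mx_normrE.
  apply: bigmax_lt => // -[i0 i] _; rewrite mxE/=.
  rewrite -(@ltr_pXn2r _ 2)// ?nnegrE ?(ltW de0)// real_normK ?num_real//.
  apply: le_lt_trans qt; rewrite /q (bigD1 i)//= lerDl.
  by apply: sumr_ge0 => l _; exact: sqr_ge0.
(* In the cube of half-side e the sum of squares is at most n e, since e <= 1, and (n + 1) e <= de^2
   / 2. *)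
- have e0 : 0 < Num.min 1 (de ^+ 2 / 2 / n.+1%:R).
    by rewrite lt_min ltr01/= !divr_gt0.
  apply: lt_le_trans (tuple_measure_box_gt0 n e0) _.
  set e := Num.min _ _ in e0 *.
  have mB (r : R) (f : n.-tuple R -> R) : measurable_fun setT f -> measurable [set t | f t < r].
    move=> mf; rewrite (_ : [set t | _] = setT `&` f @^-1` `]-oo, r[%classic); first exact: mf.
    by rewrite setTI; apply/seteqP; split => t; rewrite /= in_itv.
  apply: le_measure; rewrite ?inE.
  + rewrite (_ : [set t | _] = \bigcap_(i in [set: 'I_n]) [set t : n.-tuple R | `|tnth t i| < e]).
      apply: fin_bigcap_measurable => // i _; apply: mB.
      by apply: measurableT_comp => //; exact: measurable_tnth.
    by apply/seteqP; split => t /= h i; [move=> _; exact: h|exact: h].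
  + exact: mB.
  + move=> t /= ht; apply: (@le_lt_trans _ _ (n%:R * e)).
      rewrite /q; apply: (@le_trans _ _ (\sum_(i < n) e)); last first.
        by rewrite sumr_const card_ord mulr_natl.
      apply: ler_sum => i _; rewrite -real_normK ?num_real// expr2.
      apply: (@le_trans _ _ (e * 1)); last by rewrite mulr1.
      apply: ler_pM => //; first exact: ltW.
      by apply: le_trans (ltW (ht i)) _; rewrite ge_min lexx.
    apply: (@lt_le_trans _ _ (n.+1%:R * e)); first by rewrite ltr_pM2r// ltr_nat.
    by rewrite mulrC -ler_pdivlMr// ge_min lexx orbT.
- move=> y y0; rewrite -[RHS](key y (index_enum 'I_n) 0 y0); apply: eq_Rintegral => t _.
  by rewrite (_ : dotv 0 _ = 0) ?mulr0 ?cos0 ?mulr1// /dotv mul0mx mxE.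
Qed.

End CosineUniqueness.

(** * The Wigner integrand and its Gaussian bounds *)

Section Wigner.
Context {R : realType} (n : nat).
Implicit Types (f : 'rV[R]_n -> R[i]) (x y xi : 'rV[R]_n).

Notation Re := complex.Re.
Notation Im := complex.Im.

Definition wigner_re f x y : R :=
  Re (f (x + 2^-1 *: y)) * Re (f (x - 2^-1 *: y)) +
  Im (f (x + 2^-1 *: y)) * Im (f (x - 2^-1 *: y)).

Definition wigner_im f x y : R :=
  Im (f (x + 2^-1 *: y)) * Re (f (x - 2^-1 *: y)) -
  Re (f (x + 2^-1 *: y)) * Im (f (x - 2^-1 *: y)).

(** The real part of f(x+y/2) conj(f(x-y/2)) exp(-2 pi i xi.y). Its component [wigner_re] is even in
    y and equals |f(x)|^2 at y = 0. *)
Definition wigner_kernel f x xi y : R :=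
  wigner_re f x y * cos (2 * pi * dotv xi y) + wigner_im f x y * sin (2 * pi * dotv xi y).

Lemma Re_wigner f (z : 'rV[R]_(n + n)) :
  Re (wigner f f z) = Rd_int (wigner_kernel f (lsubmx z) (rsubmx z)).
Proof.
rewrite /wigner /Rd_cint /=; congr Rd_int; apply/funext => y.
rewrite /wigner_kernel /wigner_re /wigner_im.
move: (f _) (f _) => [a b] [c d] /=.
by rewrite cosN sinN -mulrA; ring.
Qed.

(** Cauchy-Schwarz against the unit vector (cos, sin): the defect is the square of X sin - Y cos. *)
Lemma wigner_kernel_le f x xi y :
  `|wigner_kernel f x xi y| <= cmod (f (x + 2^-1 *: y)) * cmod (f (x - 2^-1 *: y)).
Proof.
rewrite /wigner_kernel /wigner_re /wigner_im /cmod.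
move: (f _) (f _) => [c d] [a b] /=; set th := 2 * pi * _.
rewrite -sqrtrM ?addr_ge0 ?sqr_ge0// -sqrtr_sqr; apply: ler_wsqrtr.
rewrite -subr_ge0; have e := cos2Dsin2 th.
have -> : (a ^+ 2 + b ^+ 2) * (c ^+ 2 + d ^+ 2) =
    ((a * c + b * d) ^+ 2 + (b * c - a * d) ^+ 2) * (cos th ^+ 2 + sin th ^+ 2).
  by rewrite e; ring.
set X := a * c + b * d; set Y := b * c - a * d.
have -> : (X ^+ 2 + Y ^+ 2) * (cos th ^+ 2 + sin th ^+ 2) - (X * cos th + Y * sin th) ^+ 2 =
  (X * sin th - Y * cos th) ^+ 2 by ring.
exact: sqr_ge0.
Qed.

Definition row_measurable f :=
  Rd_measurable_fun (fun x => Re (f x)) /\ Rd_measurable_fun (fun x => Im (f x)).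

Lemma measurable_shift (F : 'rV[R]_n -> R) x s : Rd_measurable_fun F ->
  measurable_fun setT (fun t : n.-tuple R => F (x + s *: row_of_tuple t)).
Proof.
move=> mF; under eq_fun do rewrite -row_of_tuple_affine.
exact: (measurableT_comp mF (measurable_tuple_affine x s)).
Qed.

Lemma measurable_shiftN (F : 'rV[R]_n -> R) x s : Rd_measurable_fun F ->
  measurable_fun setT (fun t : n.-tuple R => F (x - s *: row_of_tuple t)).
Proof.
move=> mF; have := measurable_shift x (- s) mF.
by congr (measurable_fun _ _); apply/funext => t; rewrite scaleNr.
Qed.

Lemma measurable_wigner_re f x : row_measurable f ->
  measurable_fun setT (fun t : n.-tuple R => wigner_re f x (row_of_tuple t)).
Proof.
move=> [mr mi].
exact: (measurable_funD
  (measurable_funM (measurable_shift x 2^-1 mr) (measurable_shiftN x 2^-1 mr))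
  (measurable_funM (measurable_shift x 2^-1 mi) (measurable_shiftN x 2^-1 mi))).
Qed.

Lemma measurable_wigner_im f x : row_measurable f ->
  measurable_fun setT (fun t : n.-tuple R => wigner_im f x (row_of_tuple t)).
Proof.
move=> [mr mi].
exact: (measurable_funB
  (measurable_funM (measurable_shift x 2^-1 mi) (measurable_shiftN x 2^-1 mr))
  (measurable_funM (measurable_shift x 2^-1 mr) (measurable_shiftN x 2^-1 mi))).
Qed.

Lemma measurable_wigner_kernel f x xi : row_measurable f ->
  measurable_fun setT (fun t : n.-tuple R => wigner_kernel f x xi (row_of_tuple t)).
Proof.
move=> mf.
have mth : measurable_fun setT (fun t : n.-tuple R => 2 * pi * dotv xi (row_of_tuple t)).
  by apply: measurable_funM => //; exact: measurable_dotv_row.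
apply: measurable_funD; apply: measurable_funM.
- exact: measurable_wigner_re.
- by apply: (measurableT_comp _ mth); apply: continuous_measurable_fun; exact: continuous_cos.
- exact: measurable_wigner_im.
- by apply: (measurableT_comp _ mth); apply: continuous_measurable_fun; exact: continuous_sin.
Qed.

Lemma measurable_qform_row (K : 'M[R]_n) :
  measurable_fun setT (fun t : n.-tuple R => qform K (row_of_tuple t)).
Proof.
under eq_fun do rewrite /qform dotvE.
apply: measurable_sum => i; apply: measurable_funM; last first.
  by under eq_fun do rewrite mxE; exact: measurable_tnth.
under eq_fun do rewrite mxE.
apply: measurable_sum => j; apply: measurable_funM => //.
by under eq_fun do rewrite mxE; exact: measurable_tnth.
Qed.

Lemma integrable_gauss_qform (K : 'M[R]_n) (a : R) : posdef K -> 0 < a ->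
  (tuple_measure n).-integrable setT
    (EFin \o (fun t => expR (- (a * qform K (row_of_tuple t))))).
Proof.
move=> pK a0; have [kap kap0 hk] := posdef_coercive pK.
have ak : 0 < a / kap by rewrite divr_gt0.
apply: le_integrable_real (integrable_gauss_tuple n ak).
  apply: measurableT_comp => //; apply: measurableT_comp => //.
  by apply: measurable_funM => //; exact: measurable_qform_row.
move=> t; rewrite ger0_norm ?expR_ge0// ler_expR lerN2 -mulrA ler_pM2l//.
rewrite mulrC ler_pdivrMr// mulrC; apply: le_trans (hk _).
by rewrite le_eqVlt; apply/orP; left; apply/eqP; apply: eq_bigr => i _; rewrite mxE.
Qed.

Definition wigner_bound (K : 'M[R]_n) (c : R) x (t : n.-tuple R) : R :=
  c ^+ 2 * expR (- (2 * pi * qform K x)) * expR (- (pi / 2 * qform K (row_of_tuple t))).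

Lemma wigner_bound_ge0 (K : 'M[R]_n) c x t : 0 <= wigner_bound K c x t.
Proof. exact: mulr_ge0 (mulr_ge0 (sqr_ge0 _) (expR_ge0 _)) (expR_ge0 _). Qed.

Lemma integrable_wigner_bound (K : 'M[R]_n) c x : posdef K ->
  (tuple_measure n).-integrable setT (EFin \o wigner_bound K c x).
Proof.
move=> pK; apply: integrableZ_real; apply: integrable_gauss_qform => //.
by rewrite divr_gt0// pi_gt0.
Qed.

Lemma wigner_kernel_bound (K : 'M[R]_n) f c x xi t : posdef K ->
  cmod (f (x + 2^-1 *: row_of_tuple t)) <= c * expR (- (pi * qform K (x + 2^-1 *: row_of_tuple t))) ->
  cmod (f (x - 2^-1 *: row_of_tuple t)) <= c * expR (- (pi * qform K (x - 2^-1 *: row_of_tuple t))) ->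
  `|wigner_kernel f x xi (row_of_tuple t)| <= wigner_bound K c x t.
Proof.
move=> pK h1 h2; apply: le_trans (wigner_kernel_le _ _ _ _) _.
apply: le_trans (ler_pM (sqrtr_ge0 _) (sqrtr_ge0 _) h1 h2) _.
rewrite mulrACA -expRD -expr2 /wigner_bound -mulrA -expRD le_eqVlt.
apply/orP; left; apply/eqP; congr (_ * expR _).
rewrite -!opprD -!mulrDr; congr (- _); rewrite qform_parallelogram//.
by move: (@pi R) => p; field.
Qed.

Lemma ae_Rd_shift (P : 'rV[R]_n -> Prop) x s : s != 0 -> ae_Rd P ->
  {ae tuple_measure n, forall t, P (x + s *: row_of_tuple t)}.
Proof.
move=> s0 [B [mB PB B0]].
have mB' : measurable (@row_of_tuple R n @^-1` B) by exact: mB.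
have N0 : tuple_measure n (@row_of_tuple R n @^-1` B) = 0%E.
  rewrite Rd_int_nnE in B0; last 2 first.
  - have -> : (fun y => (\1_B y : R)%:E) \o @row_of_tuple R n =
      EFin \o (\1_(@row_of_tuple R n @^-1` B) : n.-tuple R -> R) by [].
    by apply/measurable_EFinP; exact: measurable_indic.
  - by move=> y; rewrite lee_fin.
  by rewrite -(setIT (_ @^-1` B)) -integral_indic.
exists (tuple_affine x s @^-1` (@row_of_tuple R n @^-1` B)); split.
- by rewrite -[X in measurable X]setTI; exact: measurable_tuple_affine.
- exact: tuple_measure_null_affine.
- by move=> t /= nP; apply: PB => /=; rewrite row_of_tuple_affine.
Qed.

(** The metaplectic image is bounded almost everywhere only; for fixed x the exceptional t are null
    for both shifts. Integrability is what identifies the iterated integral with the integral over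
    tuples. *)
Lemma integral_wigner_kernel_ae (K : 'M[R]_n) f c x xi : posdef K -> row_measurable f ->
  ae_Rd (fun y => cmod (f y) <= c * expR (- (pi * qform K y))) ->
  (tuple_measure n).-integrable setT (EFin \o (fun t => wigner_kernel f x xi (row_of_tuple t))) /\
  `|\int[tuple_measure n]_t wigner_kernel f x xi (row_of_tuple t)| <=
    \int[tuple_measure n]_t wigner_bound K c x t.
Proof.
move=> pK mf hae.
have mk := measurable_wigner_kernel x xi mf.
have ib := integrable_wigner_bound c x pK.
have le_int : (\int[tuple_measure n]_t `|(wigner_kernel f x xi (row_of_tuple t))%:E| <=
    \int[tuple_measure n]_t (wigner_bound K c x t)%:E)%E.
  apply: ae_ge0_le_integral => //.
  - by apply: measurableT_comp => //; exact/measurable_EFinP.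
  - by move=> t _; rewrite lee_fin wigner_bound_ge0.
  - by case/integrableP : ib.
  have h1 := @ae_Rd_shift _ x (2^-1) _ hae.
  have h2 := @ae_Rd_shift _ x (- 2^-1) _ hae.
  have nz : (2^-1 : R) != 0 by rewrite invr_eq0.
  have nz' : - (2^-1 : R) != 0 by rewrite oppr_eq0.
  apply: filterS2 (h1 nz) (h2 nz') => t k1 k2 _; rewrite lee_fin.
  by apply: wigner_kernel_bound => //; rewrite -scaleNr.
have ik : (tuple_measure n).-integrable setT
    (EFin \o (fun t => wigner_kernel f x xi (row_of_tuple t))).
  apply/integrableP; split; first exact/measurable_EFinP.
  apply: le_lt_trans le_int _.
  have /integrableP[_] := ib; apply: le_lt_trans.
  rewrite le_eqVlt; apply/orP; left; apply/eqP; apply: eq_integral => t _ /=.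
  by rewrite ger0_norm// wigner_bound_ge0.
split => //.
apply: le_trans (le_normr_Rintegral measurableT ik) _.
rewrite /Rintegral; apply: fine_le => //.
- by apply: integrable_fin_num => //; exact: (integrable_norm ik).
- exact: integrable_fin_num.
Qed.

Lemma wigner_bound_integral (K : 'M[R]_n) c x : posdef K ->
  \int[tuple_measure n]_t wigner_bound K c x t =
  c ^+ 2 * \int[tuple_measure n]_t expR (- (pi / 2 * qform K (row_of_tuple t))) *
  expR (- (2 * pi * qform K x)).
Proof.
move=> pK; rewrite RintegralZl//; first by rewrite mulrAC.
by apply: integrable_gauss_qform => //; rewrite divr_gt0// pi_gt0.
Qed.

End Wigner.

Section Symplectic.
Context {R : realType} (d : nat).

Lemma mxapp_row_mx (S : 'M[R]_(d + d)) (x xi : 'rV[R]_d) :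
  lsubmx (mxapp S (row_mx x xi)) = x *m (ulsubmx S)^T + xi *m (ursubmx S)^T.
Proof.
rewrite /mxapp -{1}(submxK S) tr_row_mx mul_block_col tr_col_mx row_mxKl.
by rewrite linearD /= !trmx_mul !trmxK.
Qed.

Lemma mxapp_invK (S : 'M[R]_(d + d)) z : S \in unitmx -> mxapp (invmx S) (mxapp S z) = z.
Proof. by move=> uS; rewrite /mxapp trmxK mulKmx// trmxK. Qed.

End Symplectic.

Lemma continuous_dotv (R : realType) d (w : 'rV[R]_d) : continuous (dotv w).
Proof.
have -> : dotv w = fun y : 'rV[R]_d => \sum_(i <- index_enum 'I_d) w 0 i * y 0 i.
  by apply/funext => y; exact: dotvE.
elim: (index_enum _) => [|i s IH] y.
  rewrite (_ : (fun _ => _) = cst 0); first exact: cst_continuous.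
  by apply/funext => z; rewrite big_nil.
rewrite (_ : (fun _ => _) = fun y : 'rV[R]_d => w 0 i * y 0 i + \sum_(i <- s) w 0 i * y 0 i); last first.
  by apply/funext => z; rewrite big_cons.
exact: (cvgD (cvgM (cvg_cst (w 0 i)) (@coord_continuous R 1 d 0 i y)) (IH y)).
Qed.

(** * Hardy's theorem in the direction w *)

Section Hardy.
Context {R : realType} (d : nat).
Variables (M N B : 'M[R]_d) (u0 : 'rV[R]_d -> R[i]) (c : R) (x y0 : 'rV[R]_d).
Hypotheses (pM : posdef M) (pN : posdef N).
Hypothesis cu0 : continuous (fun y => complex.Re (u0 y)) /\ continuous (fun y => complex.Im (u0 y)).
Hypothesis hu0 : forall y, cmod (u0 y) <= c * expR (- (pi * qform M y)).
Variable C : R.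
Hypothesis hC : forall xi,
  `|\int[tuple_measure d]_t wigner_kernel u0 x xi (row_of_tuple t)| <=
  C * expR (- (2 * pi * qform N (y0 + xi *m B^T))).

Let mu0 : row_measurable u0.
Proof. by split; apply: measurable_continuous_row; case: cu0. Qed.

Let kern xi (t : d.-tuple R) := wigner_kernel u0 x xi (row_of_tuple t).

Let kern_le xi t : `|kern xi t| <= wigner_bound M c x t.
Proof. by apply: wigner_kernel_bound. Qed.

Let integrable_kern xi : (tuple_measure d).-integrable setT (EFin \o kern xi).
Proof.
exact: (le_integrable_real (measurable_wigner_kernel x xi mu0) (kern_le xi)
  (integrable_wigner_bound c x pM)).
Qed.

(** Product-to-sum formulas. Decay of the Wigner distribution in xi thereby becomes decay of a
    one-variable cosine transform. *)
Let cos_transform_kern w xi s :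
  cos_transform (tuple_measure d) (kern xi) (fun t => dotv w (row_of_tuple t)) s =
  2^-1 * (\int[tuple_measure d]_t kern (xi + s *: w) t +
          \int[tuple_measure d]_t kern (xi - s *: w) t).
Proof.
rewrite -RintegralD// -RintegralZl//; last first.
  exact: (integrableD measurableT (integrable_kern _) (integrable_kern _)).
apply: eq_Rintegral => t _; rewrite /kern /wigner_kernel.
rewrite -scaleNr !dotvDl !dotvZl mulNr (mulrDr (2 * pi)) (mulrBr (2 * pi)).
rewrite cosD sinD cosB sinB [2 * pi * (s * _)]mulrA.
by field.
Qed.

(* Completing the square: the exponent of the decay in the direction [w] can be any
   number below 2 N(wB^T).(wB^T), at the cost of the constant. *)
Let cos_transform_decay w xi b : b < 2 * qform N (w *m B^T) ->
  exists K, forall s,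
    `|cos_transform (tuple_measure d) (kern xi) (fun t => dotv w (row_of_tuple t)) s| <=
    K * expR (- (b * (pi * s ^+ 2))).
Proof.
move=> hb; pose y1 := y0 + xi *m B^T; pose eta := w *m B^T.
pose de := 2 * qform N eta - b; have de0 : 0 < de by rewrite subr_gt0.
pose be := bform N y1 eta.
(* The constant term of the completed square (de s + 2 be)^2 / de. *)
pose K0 := 4 * be ^+ 2 / de.
have C0 : 0 <= C.
  have := le_trans (normr_ge0 _) (hC 0); rewrite pmulr_lge0// expR_gt0//.
exists (C * expR (pi * K0)) => s.
have aux (s' : R) : `|\int[tuple_measure d]_t kern (xi + s' *: w) t| <=
    C * expR (pi * K0) * expR (- (b * (pi * s' ^+ 2))).
  apply: le_trans (hC _) _; rewrite -[leRHS]mulrA -expRD ler_wpM2l// ler_expR.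
  have -> : y0 + (xi + s' *: w) *m B^T = y1 + s' *: eta by rewrite mulmxDl -scalemxAl addrA.
  rewrite (qformD pN) (qformZ pN) (bformZr pN) -/be.
  have q1 := qform_ge0 pN y1.
  have sq : 0 <= (de * s' + 2 * be) ^+ 2 / de by rewrite divr_ge0 ?sqr_ge0// ltW.
  have -> : pi * K0 + - (b * (pi * s' ^+ 2)) = - (pi * (b * s' ^+ 2 - K0)) by ring.
  rewrite lerN2 -[2 * pi]mulrC -mulrA ler_wpM2l ?pi_ge0//.
  have e : (de * s' + 2 * be) ^+ 2 / de = de * s' ^+ 2 + 4 * be * s' + K0.
    by rewrite /K0; field; exact: lt0r_neq0.
  move: sq; rewrite e /de; lra.
rewrite cos_transform_kern normrM ger0_norm ?invr_ge0//.
have a1 := aux s; have a2 := aux (- s); rewrite scaleNr sqrrN in a2.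
have := ler_normD (\int[tuple_measure d]_t kern (xi + s *: w) t)
  (\int[tuple_measure d]_t kern (xi - s *: w) t).
move: a1 a2; lra.
Qed.

Lemma hardy_wigner_eq0 (v : 'rV[R]_d) (lam : R) : 1 < lam -> v != 0 ->
  v *m (M *m B^T *m N *m B) = lam *: v -> u0 x = 0.
Proof.
move=> lam1 v0 hv; pose w := v *m M; pose q := qform M v.
have q0 : 0 < q by exact: pM.2.
(* Written out, the left-hand side is v (M B^T N B) (v M)^T, to which the eigenvector equation
   applies. *)
have qeta : qform N (w *m B^T) = lam * q.
  rewrite qformE// /bform /w trmx_mul trmxK.
  rewrite (_ : v *m M *m B^T *m N *m (B *m (v *m M)^T) =
    v *m (M *m B^T *m N *m B) *m (v *m M)^T); last by rewrite !mulmxA.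
  rewrite hv -scalemxAl mxE /q qformE// /bform trmx_mul pM.1 mulmxA//.
have dotw t : dotv w (row_of_tuple t) = bform M v (row_of_tuple t) by [].
(* The interval from 1/(2 lam q) to 1/(2q) is nonempty as lam > 1; z is its midpoint, and a <
   1/(2q), b < 2 lam q satisfy 1/b < z < a. *)
pose z := (1 / (2 * lam * q) + 1 / (2 * q)) / 2.
pose a := (z + 1 / (2 * q)) / 2.
pose b := (z^-1 + 2 * lam * q) / 2.
have lq : 0 < 2 * lam * q by rewrite !mulr_gt0//; lra.
have i1 : 0 < 1 / (2 * lam * q) by rewrite divr_gt0.
have i2 : 1 / (2 * lam * q) < 1 / (2 * q).
  by rewrite !div1r ltf_pV2 ?posrE// ?mulr_gt0// ltr_pM2r// ltr_pMr.
have z1 : 1 / (2 * lam * q) < z by rewrite /z; lra.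
have z2 : z < 1 / (2 * q) by rewrite /z; lra.
have z0 : 0 < z by lra.
have zi : z^-1 < 2 * lam * q.
  by move: z1; rewrite div1r invf_plt ?posrE.
have zi0 : 0 < z^-1 by rewrite invr_gt0.
have b1 : z^-1 < b by rewrite /b; lra.
have b2 : b < 2 * lam * q by rewrite /b; lra.
have b0 : 0 < b by lra.
have a1 : z < a by rewrite /a; lra.
have a2 : a < 1 / (2 * q) by rewrite /a; lra.
have a0 : 0 < a by lra.
have bz : b^-1 < z by rewrite invf_plt ?posrE.
have mr := measurable_dotv_row w.
have ihardy xi : (tuple_measure d).-integrable setT
    (EFin \o (fun t => `|kern xi t| * expR (a * (pi * dotv w (row_of_tuple t) ^+ 2)))).
  (* Cauchy-Schwarz gives (w.t)^2 <= q Mt.t, so the exponent pi/2 Mt.t keeps the positive share pi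
     (1/2 - a q) Mt.t after multiplication by exp(a pi (w.t)^2). *)
  have e0 : 0 < pi * (2^-1 - a * q).
    rewrite mulr_gt0 ?pi_gt0// subr_gt0 -ltr_pdivlMr//.
    by move: a2; rewrite mul1r invfM.
  have := integrableZ_real (c ^+ 2 * expR (- (2 * pi * qform M x)))
    (integrable_gauss_qform pM e0).
  apply: le_integrable_real.
    apply: measurable_funM; apply: measurableT_comp => //.
      exact: measurable_wigner_kernel.
    by apply: measurable_funM => //; apply: measurable_funM => //; exact: measurable_funX.
  move=> t; rewrite normrM normr_id (gtr0_norm (expR_gt0 _)).
  apply: le_trans (ler_wpM2r (expR_ge0 _) (kern_le xi t)) _.
  rewrite /wigner_bound -[leLHS]mulrA.
  rewrite (ler_wpM2l (mulr_ge0 (sqr_ge0 c) (expR_ge0 _)))//.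
  rewrite -expRD ler_expR dotw.
  have := bform_cauchy_schwarz pM v (row_of_tuple t); rewrite -/q => cs.
  have := ler_wpM2l (mulr_ge0 (ltW a0) (pi_ge0 R)) cs; lra.
have hz xi : \int[tuple_measure d]_t (kern xi t *
    expR (- (z * (pi * dotv w (row_of_tuple t) ^+ 2)))) = 0.
  have [|K hK] := @cos_transform_decay w xi b; first by rewrite qeta mulrA.
  apply: (hardy_laplace_eq0 (measurable_wigner_kernel x xi mu0) mr a0 b0 (ihardy xi) hK).
  by rewrite bz.
pose G y := wigner_re u0 x y * expR (- (z * (pi * dotv w y ^+ 2))).
have iz xi : (tuple_measure d).-integrable setT (EFin \o (fun t => kern xi t *
    expR (- (z * (pi * dotv w (row_of_tuple t) ^+ 2))))).
  apply: le_integrable_real (integrable_norm (integrable_kern xi)).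
    apply: measurable_funM; first exact: measurable_wigner_kernel.
    apply: measurableT_comp => //; apply: measurableT_comp => //.
    by apply: measurable_funM => //; apply: measurable_funM => //; exact: measurable_funX.
  move=> t; rewrite normrM ler_piMr// gtr0_norm ?expR_gt0// -[leRHS]expR0 ler_expR.
  by rewrite oppr_le0 (mulr_ge0 (ltW z0))// mulr_ge0 ?pi_ge0// sqr_ge0.
have kern0 t : kern 0 t = wigner_re u0 x (row_of_tuple t).
  rewrite /kern /wigner_kernel (_ : dotv 0 _ = 0); last by rewrite /dotv mul0mx mxE.
  by rewrite mulr0 cos0 sin0 mulr1 mulr0 addr0.
have G0 : G 0 <= 0.
  apply: (@cos_transform_eq0_le0 _ d G).
  - have := iz 0; apply: eq_integrable => // t _ /=.
    by rewrite kern0.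
  - have shift s : x + s *: y @[y --> (0 : 'rV[R]_d)] --> x + s *: (0 : 'rV[R]_d).
      have h : s *: y @[y --> (0 : 'rV[R]_d)] --> s *: (0 : 'rV[R]_d).
        exact: scaler_continuous.
      exact: (cvgD (cvg_cst x) h).
    have [cr ci] := cu0.
    have cs (F : 'rV[R]_d -> R) s : continuous F ->
        F (x + s *: y) @[y --> (0 : 'rV[R]_d)] --> F (x + s *: (0 : 'rV[R]_d)).
      by move=> cF; apply: (cvg_comp _ _ (shift s)); exact: cF.
    have cs' (F : 'rV[R]_d -> R) s : continuous F ->
        F (x - s *: y) @[y --> (0 : 'rV[R]_d)] --> F (x - s *: (0 : 'rV[R]_d)).
      move=> cF; have := cs F (- s) cF; rewrite scaleNr.
      by under eq_fun do rewrite scaleNr.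
    have cd := @continuous_dotv R d w 0.
    have ce : expR (- (z * (pi * dotv w y ^+ 2))) @[y --> (0 : 'rV[R]_d)] -->
        expR (- (z * (pi * dotv w 0 ^+ 2))).
      apply: (cvg_comp (fun y => - (z * (pi * dotv w y ^+ 2))) expR); last exact: continuous_expR.
      exact: (cvgN (cvgM (cvg_cst z) (cvgM (cvg_cst pi) (cvgM cd cd)))).
    exact: (cvgM (cvgD (cvgM (cs _ 2^-1 cr) (cs' _ 2^-1 cr))
      (cvgM (cs _ 2^-1 ci) (cs' _ 2^-1 ci))) ce).
  (* Adding the identities at xi and -xi removes the sine part. *)
  - move=> xi; have h1 := hz xi; have h2 := hz (- xi).
    have := RintegralD measurableT (iz xi) (iz (- xi)); rewrite h1 h2 addr0 => h3.
    apply: (mulfI (_ : (2 : R) != 0)); first by rewrite pnatr_eq0.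
    rewrite mulr0 -h3 -RintegralZl//.
      apply: eq_Rintegral => t _; rewrite /G /kern /wigner_kernel.
      by rewrite -(scaleN1r xi) dotvZl mulN1r mulrN cosN sinN; ring.
    have iG : (tuple_measure d).-integrable setT (EFin \o (fun t => G (row_of_tuple t))).
      by have := iz 0; apply: eq_integrable => // t _ /=; rewrite kern0.
    apply: le_integrable_real (integrable_norm iG).
      apply: measurable_funM; first exact: measurable_integrable iG.
      apply: (@measurableT_comp _ _ _ _ _ _ (@cos R)).
        by apply: continuous_measurable_fun; exact: continuous_cos.
      by apply: measurable_funM => //; exact: measurable_dotv_row.
    by move=> t; exact: ler_norm_mul_cos.
move: G0; rewrite /G /wigner_re scaler0 subr0 addr0.
rewrite (_ : dotv w 0 = 0); last by rewrite /dotv trmx0 mulmx0 mxE.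
rewrite expr0n/= !mulr0 oppr0 expR0 mulr1 -!expr2.
case: (u0 x) => re im /= h.
have : re ^+ 2 + im ^+ 2 == 0 by rewrite eq_le h addr_ge0 ?sqr_ge0.
by rewrite paddr_eq0 ?sqr_ge0// !sqrf_eq0 => /andP[/eqP-> /eqP->].
Qed.

End Hardy.

Theorem theorem1p7 (R : realType) (d : nat) (Mc : 'M[R]_(d + d))
    (U : R -> ('rV[R]_d -> R[i]) -> ('rV[R]_d -> R[i]))
    (u0 : 'rV[R]_d -> R[i]) (M N : 'M[R]_d) (t1 c : R) :
  Mc^T = Mc ->
  metaplectic_lift Mc U ->
  schwartz u0 ->
  posdef M -> posdef N -> 0 < c ->
  (forall x, cmod (u0 x) <= c * expR (- (pi * qform M x))) ->
  ae_Rd (fun x => cmod (U t1 u0 x) <= c * expR (- (pi * qform N x))) ->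
  ursubmx (symp_flow Mc t1) \in unitmx ->
  (exists lam : R, 1 < lam /\
     eigenvalue (M *m (ursubmx (symp_flow Mc t1))^T *m N *m ursubmx (symp_flow Mc t1)) lam) ->
  forall x, u0 x = 0.
Proof.
move=> _ [hmeta _ _] [sr si] pM pN c0 hu0 hu1 _ [lam [lam1 /eigenvalueP[v hv v0]]] x.
set S := symp_flow Mc t1 in hv *.
have uS : S \in unitmx by exact: expmx_unit.
have [VL2 _ _ _ Vwig] := hmeta t1; rewrite -/S in Vwig.
have cu0 : continuous (fun y => complex.Re (u0 y)) /\ continuous (fun y => complex.Im (u0 y)).
  by split => y; apply: differentiable_continuous; [exact: (sr.1 [::] y)|exact: (si.1 [::] y)].
have mu0 : row_measurable u0.
  by split; apply: measurable_continuous_row; case: cu0.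
(* The metaplectic properties concern L^2; continuity and the Gaussian bound place [u0] there. *)
have L2u0 : L2 u0.
  have mcm : measurable_fun setT (fun t : d.-tuple R => cmod (u0 (row_of_tuple t)) ^+ 2).
    have e t : cmod (u0 (row_of_tuple t)) ^+ 2 =
        complex.Re (u0 (row_of_tuple t)) ^+ 2 + complex.Im (u0 (row_of_tuple t)) ^+ 2.
      by rewrite sqr_sqrtr// addr_ge0 ?sqr_ge0.
    under eq_fun do rewrite e.
    by apply: measurable_funD; apply: measurable_funX; [exact: mu0.1|exact: mu0.2].
  split; [exact: mu0.1|exact: mu0.2|].
  rewrite /L2norm2 Rd_int_nnE; last 2 first.
  - exact/measurable_EFinP.
  - by move=> y; rewrite lee_fin sqr_ge0.
  have p0 : 0 < 2 * pi :> R by rewrite mulr_gt0// pi_gt0.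
  have := integrableZ_real (c ^+ 2) (integrable_gauss_qform pM p0).
  have b t : `|cmod (u0 (row_of_tuple t)) ^+ 2| <=
      c ^+ 2 * expR (- (2 * pi * qform M (row_of_tuple t))).
    rewrite ger0_norm ?sqr_ge0//.
    apply: le_trans (lerXn2r 2 _ _ (hu0 _)) _; rewrite ?nnegrE ?sqrtr_ge0//.
      by rewrite mulr_ge0 ?expR_ge0// ltW.
    by rewrite exprMn -expRM_natl -mulr_natl mulrN mulrA mulr_natl lexx.
  move=> /(le_integrable_real mcm b)/integrableP[_]; apply: le_lt_trans.
  rewrite le_eqVlt; apply/orP; left; apply/eqP; apply: eq_integral => t _ /=.
  by rewrite ger0_norm// sqr_ge0.
have [mr1 mi1 _] := VL2 _ L2u0.
pose J := \int[tuple_measure d]_t expR (- (pi / 2 * qform N (row_of_tuple t))).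
have hC xi : `|\int[tuple_measure d]_t wigner_kernel u0 x xi (row_of_tuple t)| <=
    c ^+ 2 * J * expR (- (2 * pi * qform N (x *m (ulsubmx S)^T + xi *m (ursubmx S)^T))).
  (* At z = S(x, xi) the Wigner distribution of [U t1 u0] is that of [u0] at (x, xi), and the first
     half of z is Ax + B xi, where the bound with N is evaluated. *)
  pose z0 := row_mx x xi; pose z := mxapp S z0.
  have : complex.Re (wigner (U t1 u0) (U t1 u0) z) = complex.Re (wigner u0 u0 z0).
    by rewrite Vwig// mxapp_invK.
  rewrite !Re_wigner row_mxKl row_mxKr.
  have [ik hk] := integral_wigner_kernel_ae (lsubmx z) (rsubmx z) pN (conj mr1 mi1) hu1.
  rewrite (Rd_intE ik).
  have hu0ae : ae_Rd (fun y => cmod (u0 y) <= c * expR (- (pi * qform M y))).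
    exists set0; split.
    - by rewrite /Rd_measurable preimage_set0.
    - by move=> y /=; apply; exact: hu0.
    - rewrite Rd_int_nnE.
      + by rewrite (eq_integral (cst 0%E)) ?integral0// => t _; rewrite indicE in_set0.
      + have -> : (fun y => (\1_set0 y : R)%:E) \o @row_of_tuple R d = cst 0%E.
          by apply/funext => t /=; rewrite indicE in_set0.
        exact: measurable_cst.
      + by move=> y; rewrite lee_fin.
  have [ik0 _] := integral_wigner_kernel_ae x xi pM mu0 hu0ae.
  rewrite (Rd_intE ik0) => <-.
  by rewrite -mxapp_row_mx -wigner_bound_integral.
exact: (hardy_wigner_eq0 pM pN cu0 hu0 hC lam1 v0 hv).
Qed.
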